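(* Let $[x:y] \in \mathbb{P}^1$ and let $I(q)$ be the ideal $(ya - xb,\ a^2,\ ab,\ b^2)$ of $\Bbbk[a,b]$, which defines a point $q$ infinitely near to $(0,0)$. Let \[ P(q) = \frac{\Bbbk[a,b] + I(0,0)T}{I(0,0) + I(q)T}. \] Then $A_{[x:y]} \cong P(q)$ as left $U(W_\Gamma)$-modules.
   Context: $\Bbbk$ is an algebraically closed field of characteristic zero and $\Gamma$ is a finitely generated additive subgroup of $\Bbbk$. $W_\Gamma$ is the Lie algebra over $\Bbbk$ with basis $\{e_\nu \mid \nu \in \Gamma\}$ and bracket $[e_\mu, e_\nu] = (\nu - \mu) e_{\nu+\mu}$; $U(W_\Gamma)$ is its enveloping algebra. $T = \Bbbk[a,b]\rtimes\Gamma = \bigoplus_{\gamma\in\Gamma}\Bbbk[a,b]t^\gamma$, with $t^\gamma t^\delta = t^{\gamma+\delta}$ and $t^\gamma p(a,b) = p(a+\gamma,b)t^\gamma$. Let $\Phi: U(W_\Gamma)\to T$ be the algebra anti-homomorphism with $\Phi(e_\mu) = (a+b\mu)t^\mu$, and let $B = \Phi(U(W_\Gamma))$. Right $B$-modules are regarded as left $U(W_\Gamma)$-modules via $\Phi$, i.e. $u.m = m\,\Phi(u)$; the numerator and denominator of $P(q)$ are right $B$-submodules of $T$, and $P(q)$ is regarded as a left $U(W_\Gamma)$-module in this way. $I(0,0)$ is the ideal $(a,b)$ of $\Bbbk[a,b]$. For $(\alpha,\beta) \in \Bbbk^2\setminus\{(0,0)\}$, $A_{[\alpha:\beta]} = \bigoplus_{\nu\in\Gamma}\Bbbk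 v_\nu$ is the left $W_\Gamma$-module with \[ e_\mu v_\nu = \begin{cases} \nu\, v_{\mu+\nu} & \nu\neq 0,\ \mu+\nu\neq 0,\\ (\alpha+\beta\mu)\, v_\mu & \nu = 0,\ \mu \neq 0,\\ 0 & \mu+\nu = 0;\end{cases}\] up to isomorphism (rescaling $v_0$) it depends only on $[\alpha:\beta]\in\mathbb{P}^1$. *)

(* Defs.v *)
From HB Require Import structures.
From mathcomp Require Import all_boot all_order all_algebra finmap ring.
From mathcomp Require Import boolp.
From mathcomp.multinomials Require Import monalg mpoly.

Set Implicit Arguments.
Unset Strict Implicit.
Unset Printing Implicit Defensive.

Import GRing.Theory.
Local Open Scope ring_scope.
Local Open Scope quotient_scope.

(* [monalg.malg K V] is the direct sum of copies of V indexed by K.  The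
   library also puts the (untwisted) monoid algebra structure on it; only the
   additive and linear structures are used here. *)
Notation dsum K V := (monalg.malg K V).
Notation dsupp := monalg.msupp.
Notation dcoef := monalg.mcoeff.

(* the element c in the summand of index i; sealed, since unification is slow
   on its unfolding *)
HB.lock Definition dmono (K : choiceType) (V : zmodType) (i : K) (c : V)
  : dsum K V := monalg.mkmalgU i c.
Arguments dmono {K V}.
Canonical dmono_unlockable := Unlockable dmono.unlock.

Section Dmono.
Variables (K : choiceType) (V : zmodType).
Implicit Types (i : K) (c : V).

Lemma dcoefU i c j : dcoef j (dmono i c) = c *+ (i == j).
Proof. by rewrite unlock monalg.mcoeffU. Qed.

Lemma dmono0 i : dmono i 0 = 0 :> dsum K V.
Proof. by rewrite unlock monalg.monalgU0. Qed.

Lemma dmonoD i c d : dmono i (c + d) = dmono i c + dmono i d :> dsum K V.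
Proof. by rewrite unlock monalg.monalgUD. Qed.

Lemma dmonoN i c : dmono i (- c) = - dmono i c :> dsum K V.
Proof. by rewrite unlock monalg.monalgUN. Qed.

Lemma dmonoB i c d : dmono i (c - d) = dmono i c - dmono i d :> dsum K V.
Proof. by rewrite unlock monalg.monalgUB. Qed.

Lemma dmono_eq0 i c : (dmono i c == 0 :> dsum K V) = (c == 0).
Proof. by rewrite unlock monalg.monalgU_eq0. Qed.

End Dmono.

HB.lock Definition dext (K : choiceType) (G V : zmodType)
    (F : K -> G -> V) (x : dsum K G) : V :=
  \sum_(i <- dsupp x) F i (dcoef i x).
Canonical dext_unlockable := Unlockable dext.unlock.

Section Extension.
Variables (K : choiceType) (G V : zmodType).
Implicit Types (F : K -> G -> V).

Lemma dsum_ind (P : dsum K G -> Prop) :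
  P 0 -> (forall i c, P (dmono i c)) -> (forall x y, P x -> P y -> P (x + y)) ->
  forall x, P x.
Proof.
move=> P0 PU PD x; rewrite [x]monalg.monalgE.
by elim/big_ind: _ => // i _; move: (PU i (dcoef i x)); rewrite dmono.unlock.
Qed.

Lemma dextEw F (d : {fset K}) x : (forall i, F i 0 = 0) ->
  (dsupp x `<=` d)%fset -> dext F x = \sum_(i <- d) F i (dcoef i x).
Proof.
move=> F0 le; rewrite unlock; apply: (big_fset_incl _ le) => i _.
by move/monalg.mcoeff_outdom => ->.
Qed.

Lemma dextU F i c : (forall i, F i 0 = 0) -> dext F (dmono i c) = F i c.
Proof.
by move=> F0; rewrite dmono.unlock (dextEw F0 monalg.msuppU_le) big_seq_fset1 monalg.mcoeffUU.
Qed.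

Lemma dextD F x y : (forall i, {morph F i : a b / a + b}) ->
  dext F (x + y) = dext F x + dext F y.
Proof.
move=> FD; have F0 i : F i 0 = 0.
  by apply: (addrI (F i 0)); rewrite -FD !addr0.
pose d := (dsupp x `|` dsupp y)%fset.
rewrite (dextEw (d := d) F0) ?monalg.msuppD_le //.
rewrite (dextEw (d := d) (x := x) F0) ?fsubsetUl //.
rewrite (dextEw (d := d) (x := y) F0) ?fsubsetUr //.
by rewrite -big_split; apply: eq_bigr => i _ /=; rewrite monalg.mcoeffD FD.
Qed.

Lemma dext0 F : dext F 0 = 0.
Proof. by rewrite unlock monalg.msupp0 big_seq_fset0. Qed.

Lemma dext_addF F F' x :
  dext (fun i a => F i a + F' i a) x = dext F x + dext F' x.
Proof. by rewrite unlock big_split. Qed.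

End Extension.

Definition dext2 (K L : choiceType) (G H V : zmodType)
    (B : K -> G -> L -> H -> V) (x : dsum K G) (y : dsum L H) : V :=
  dext (fun i a => dext (fun j b => B i a j b) y) x.

Definition biadd (K L : choiceType) (G H V : zmodType)
    (B : K -> G -> L -> H -> V) : Prop :=
  (forall i j b, {morph (fun a => B i a j b) : a a' / a + a'}) /\
  (forall i a j, {morph B i a j : b b' / b + b'}).

Section Extension2.
Variables (K L : choiceType) (G H V : zmodType) (B : K -> G -> L -> H -> V).
Hypothesis Badd : biadd B.

Lemma biadd0r i a j : B i a j 0 = 0.
Proof. by apply: (addrI (B i a j 0)); rewrite -Badd.2 !addr0. Qed.

Lemma biadd0l i j b : B i 0 j b = 0.
Proof. by apply: (addrI (B i 0 j b)); rewrite -(Badd.1 i j b) !addr0. Qed.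

Lemma dext2Dl x x' y : dext2 B (x + x') y = dext2 B x y + dext2 B x' y.
Proof.
apply: dextD => i a a'; rewrite -dext_addF; congr (dext _ y).
by apply/funext => j; apply/funext => b; exact: Badd.1.
Qed.

Lemma dext2Dr x y y' : dext2 B x (y + y') = dext2 B x y + dext2 B x y'.
Proof.
rewrite /dext2 -dext_addF; congr (dext _ x).
apply/funext => i; apply/funext => a.
by apply: dextD => j b b'; apply: Badd.2.
Qed.

Lemma dext20l y : dext2 B 0 y = 0. Proof. exact: dext0. Qed.

Lemma dext20r x : dext2 B x 0 = 0.
Proof.
rewrite /dext2 [LHS](_ : _ = dext (fun _ (_ : G) => 0 : V) x).
  by rewrite unlock big1.
congr (dext _ x); apply/funext => i; apply/funext => a; exact: dext0.
Qed.

Lemma dext2U i a j b : dext2 B (dmono i a) (dmono j b) = B i a j b.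
Proof.
rewrite /dext2 dextU; first by rewrite dextU // => l; apply: biadd0r.
by move=> l; rewrite unlock big1 // => m _; apply: biadd0l.
Qed.

End Extension2.

Lemma dmonoZ (k : nzRingType) (K : choiceType) (c : k) (i : K) (a : k) :
  c *: dmono i a = dmono i (c * a) :> dsum K k.
Proof.
apply/monalg.malgP => j; rewrite monalg.mcoeffZ !dcoefU.
by rewrite mulrnAr.
Qed.

HB.mixin Record Lmodule_isLie (k : comNzRingType) g of GRing.Lmodule k g := {
  lie : g -> g -> g;
  lie_linl : forall c x y z, lie (c *: x + y) z = c *: lie x z + lie y z;
  lie_linr : forall c x y z, lie z (c *: x + y) = c *: lie z x + lie z y;
  liexx : forall x, lie x x = 0;
  lie_jacobi : forall x y z,
    lie x (lie y z) + lie y (lie z x) + lie z (lie x y) = 0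
}.

#[short(type="lieAlgType")]
HB.structure Definition LieAlgebra (k : comNzRingType) :=
  {g of Lmodule_isLie k g & GRing.Lmodule k g}.

HB.mixin Record Lmodule_isLieModule (k : comNzRingType) (g : lieAlgType k) V
    of GRing.Lmodule k V := {
  lact : g -> V -> V;
  lact_linl : forall c x y v, lact (c *: x + y) v = c *: lact x v + lact y v;
  lact_linr : forall c x u v, lact x (c *: u + v) = c *: lact x u + lact x v;
  lact_lie : forall x y v,
    lact (lie x y) v = lact x (lact y v) - lact y (lact x v)
}.

#[short(type="lieModType")]
HB.structure Definition LieModule (k : comNzRingType) (g : lieAlgType k) :=
  {V of Lmodule_isLieModule k g V & GRing.Lmodule k V}.

(* The enveloping algebra: the k-algebra presented by generators [UGen x],
   x in g, subject to linearity of [UGen] and to [x,y] = xy - yx.  Its elements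
   are algebra expressions modulo the smallest congruence [ueq] containing the
   axioms of k-algebras and these relations. *)

Inductive uterm (k g : Type) : Type :=
| UGen of g
| UConst of k
| UAdd of uterm k g & uterm k g
| UMul of uterm k g & uterm k g.

Arguments UGen {k g}.
Arguments UConst {k g}.

Inductive ueq (k : comNzRingType) (g : lieAlgType k) :
    uterm k g -> uterm k g -> Prop :=
| ueq_refl t : ueq t t
| ueq_sym t u : ueq t u -> ueq u t
| ueq_trans t u v : ueq t u -> ueq u v -> ueq t v
| ueq_add t t' u u' : ueq t t' -> ueq u u' -> ueq (UAdd t u) (UAdd t' u')
| ueq_mul t t' u u' : ueq t t' -> ueq u u' -> ueq (UMul t u) (UMul t' u')
| ueq_addA t u v : ueq (UAdd t (UAdd u v)) (UAdd (UAdd t u) v)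
| ueq_addC t u : ueq (UAdd t u) (UAdd u t)
| ueq_add0 t : ueq (UAdd (UConst 0) t) t
| ueq_addN t : ueq (UAdd (UMul (UConst (-1)) t) t) (UConst 0)
| ueq_mulA t u v : ueq (UMul t (UMul u v)) (UMul (UMul t u) v)
| ueq_mul1l t : ueq (UMul (UConst 1) t) t
| ueq_mul1r t : ueq (UMul t (UConst 1)) t
| ueq_mulDl t u v : ueq (UMul (UAdd t u) v) (UAdd (UMul t v) (UMul u v))
| ueq_mulDr t u v : ueq (UMul t (UAdd u v)) (UAdd (UMul t u) (UMul t v))
| ueq_constD c d : ueq (UConst (c + d)) (UAdd (UConst c) (UConst d))
| ueq_constM c d : ueq (UConst (c * d)) (UMul (UConst c) (UConst d))
| ueq_constC c t : ueq (UMul (UConst c) t) (UMul t (UConst c))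
| ueq_genP c x y :
    ueq (UGen (c *: x + y)) (UAdd (UMul (UConst c) (UGen x)) (UGen y))
| ueq_genL x y :
    ueq (UGen (lie x y))
        (UAdd (UMul (UGen x) (UGen y))
              (UMul (UConst (-1)) (UMul (UGen y) (UGen x)))).

HB.instance Definition _ (k g : Type) := gen_eqMixin (uterm k g).
HB.instance Definition _ (k g : Type) := gen_choiceMixin (uterm k g).

Section Eval.
Variables (k : comNzRingType) (g : lieAlgType k).

Fixpoint ueval (A : algType k) (f : g -> A) (t : uterm k g) : A :=
  match t with
  | UGen x => f x
  | UConst c => c%:A
  | UAdd t u => ueval f t + ueval f u
  | UMul t u => ueval f t * ueval f u
  end.

Fixpoint uteract (V : lieModType g) (t : uterm k g) (v : V) : V :=
  match t with
  | UGen x => lact x v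
  | UConst c => c *: v
  | UAdd t u => uteract t v + uteract u v
  | UMul t u => uteract t (uteract u v)
  end.

Definition lie_hom (A : algType k) (f : g -> A) : Prop :=
  (forall c x y, f (c *: x + y) = c *: f x + f y) /\
  (forall x y, f (lie x y) = f x * f y - f y * f x).

Lemma ueval_ueq (A : algType k) (f : g -> A) t u :
  lie_hom f -> ueq t u -> ueval f t = ueval f u.
Proof.
case=> fP fL; elim=> {t u} //=.
- by move=> t u v _ -> _ ->.
- by move=> t t' u u' _ -> _ ->.
- by move=> t t' u u' _ -> _ ->.
- by move=> t u v; rewrite addrA.
- by move=> t u; rewrite addrC.
- by move=> t; rewrite scale0r add0r.
- by move=> t; rewrite scaleN1r mulN1r addNr scale0r.
- by move=> t u v; rewrite mulrA.
- by move=> t; rewrite scale1r mul1r.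
- by move=> t; rewrite scale1r mulr1.
- by move=> t u v; rewrite mulrDl.
- by move=> t u v; rewrite mulrDr.
- by move=> c d; rewrite scalerDl.
- by move=> c d; rewrite -scalerAl mul1r scalerA.
- by move=> c t; rewrite -scalerAl -scalerAr mul1r mulr1.
- by move=> c x y; rewrite fP -scalerAl mul1r.
- by move=> x y; rewrite fL scaleN1r mulN1r.
Qed.

Lemma uteractP (V : lieModType g) t c (v w : V) :
  uteract t (c *: v + w) = c *: uteract t v + uteract t w.
Proof.
elim: t v w => [x|d|t IHt u IHu|t IHt u IHu] v w /=.
- exact: lact_linr.
- by rewrite scalerDr !scalerA mulrC.
- by rewrite IHt IHu scalerDr addrACA.
- by rewrite IHu IHt.
Qed.

Lemma uteract_ueq (V : lieModType g) t u :
  ueq t u -> uteract (V := V) t =1 uteract u.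
Proof.
elim=> {t u} //=.
- by move=> t u _ IH v; rewrite IH.
- by move=> t u v _ IH1 _ IH2 w; rewrite IH1.
- by move=> t t' u u' _ IH1 _ IH2 v; rewrite IH1 IH2.
- by move=> t t' u u' _ IH1 _ IH2 v; rewrite IH1 IH2.
- by move=> t u v w; rewrite addrA.
- by move=> t u v; rewrite addrC.
- by move=> t v; rewrite scale0r add0r.
- by move=> t v; rewrite scaleN1r addNr scale0r.
- by move=> t v; rewrite scale1r.
- by move=> t v; rewrite scale1r.
- by move=> t u v w; rewrite -{1}[uteract u w]scale1r uteractP scale1r.
- by move=> c d v; rewrite scalerDl.
- by move=> c d v; rewrite scalerA.
- move=> c t v; have t0 : uteract t (0 : V) = 0.
    by have := uteractP t (-1) (0 : V) 0; rewrite scaler0 add0r scaleN1r addNr.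
  by rewrite -[c *: v in RHS]addr0 uteractP t0 addr0.
- by move=> c x y v; rewrite lact_linl.
- by move=> x y v; rewrite lact_lie scaleN1r.
Qed.

End Eval.

Section Enveloping.
Variables (k : comNzRingType) (g : lieAlgType k).

Definition ueqb (t u : uterm k g) : bool := `[< ueq t u >].

Lemma ueqb_equiv : equiv_class_of ueqb.
Proof.
split=> [t|t u|u t v]; rewrite /ueqb.
- by apply/asboolP; exact: ueq_refl.
- by apply/asboolP/asboolP; exact: ueq_sym.
- by move=> /asboolP h /asboolP h'; apply/asboolP; exact: ueq_trans h h'.
Qed.

Canonical ueqb_equivRel := EquivRelPack ueqb_equiv.
Canonical ueqb_encModRel := defaultEncModRel ueqb.

Definition envel := {eq_quot ueqb}.
HB.instance Definition _ := Choice.on envel.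
HB.instance Definition _ := EqQuotient.on envel.

Implicit Types (t u : uterm k g) (x y z : envel).

Lemma envelP t u : (\pi_envel t = \pi_envel u) <-> ueq t u.
Proof.
split=> [/eqP|h]; last apply/eqP; rewrite piE /ueqb /=.
  by move/asboolP.
exact/asboolP.
Qed.

Lemma ueq_repr t : ueq (repr (\pi_envel t)) t.
Proof. by apply/envelP; rewrite reprK. Qed.

Definition env_add x y := \pi_envel (UAdd (repr x) (repr y)).
Definition env_mul x y := \pi_envel (UMul (repr x) (repr y)).
Definition env_scal (c : k) x := \pi_envel (UMul (UConst c) (repr x)).

Lemma env_addE t u : env_add (\pi_envel t) (\pi_envel u) = \pi_envel (UAdd t u).
Proof. by apply/envelP; apply: ueq_add; exact: ueq_repr. Qed.

Lemma env_mulE t u : env_mul (\pi_envel t) (\pi_envel u) = \pi_envel (UMul t u).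
Proof. by apply/envelP; apply: ueq_mul; exact: ueq_repr. Qed.

Lemma env_scalE c t : env_scal c (\pi_envel t) = \pi_envel (UMul (UConst c) t).
Proof. by apply/envelP; apply: ueq_mul; [exact: ueq_refl | exact: ueq_repr]. Qed.

Local Notation Q := (\pi_envel).
Let reprE x : x = Q (repr x). Proof. by rewrite reprK. Qed.

Fact env_addA : associative env_add.
Proof.
move=> x y z; rewrite (reprE x) (reprE y) (reprE z) !env_addE.
by apply/envelP; apply: ueq_addA.
Qed.

Fact env_addC : commutative env_add.
Proof.
move=> x y; rewrite (reprE x) (reprE y) !env_addE.
by apply/envelP; apply: ueq_addC.
Qed.

Fact env_add0 : left_id (Q (UConst 0)) env_add.
Proof.
by move=> x; rewrite (reprE x) env_addE; apply/envelP; apply: ueq_add0.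
Qed.

Fact env_addN : left_inverse (Q (UConst 0)) (env_scal (-1)) env_add.
Proof.
move=> x; rewrite (reprE x) env_scalE env_addE.
by apply/envelP; apply: ueq_addN.
Qed.

HB.instance Definition _ :=
  GRing.isZmodule.Build envel env_addA env_addC env_add0 env_addN.

Lemma pi_envelD t u : Q (UAdd t u) = Q t + Q u.
Proof. by rewrite -env_addE. Qed.

Fact env_mulA : associative env_mul.
Proof.
move=> x y z; rewrite (reprE x) (reprE y) (reprE z) !env_mulE.
by apply/envelP; apply: ueq_mulA.
Qed.

Fact env_mul1l : left_id (Q (UConst 1)) env_mul.
Proof.
by move=> x; rewrite (reprE x) env_mulE; apply/envelP; apply: ueq_mul1l.
Qed.

Fact env_mul1r : right_id (Q (UConst 1)) env_mul.
Proof.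
by move=> x; rewrite (reprE x) env_mulE; apply/envelP; apply: ueq_mul1r.
Qed.

Fact env_mulDl : left_distributive env_mul +%R.
Proof.
move=> x y z; rewrite (reprE x) (reprE y) (reprE z) -pi_envelD !env_mulE.
by rewrite -pi_envelD; apply/envelP; apply: ueq_mulDl.
Qed.

Fact env_mulDr : right_distributive env_mul +%R.
Proof.
move=> x y z; rewrite (reprE x) (reprE y) (reprE z) -pi_envelD !env_mulE.
by rewrite -pi_envelD; apply/envelP; apply: ueq_mulDr.
Qed.

(* the augmentation g -> 0 separates 1 from 0 *)
Fact env_1neq0 : Q (UConst 1) != 0.
Proof.
apply/eqP => /(envelP (UConst 1) (UConst 0)).
have lh : lie_hom (fun _ : g => 0 : k^o).
  by split=> *; rewrite ?scaler0 ?mulr0 ?subr0 ?addr0.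
move/(ueval_ueq lh) => /= /eqP; rewrite scale1r scale0r.
by rewrite (negPf (oner_neq0 _)).
Qed.

HB.instance Definition _ := GRing.Zmodule_isNzRing.Build envel
  env_mulA env_mul1l env_mul1r env_mulDl env_mulDr env_1neq0.

Lemma pi_envelM t u : Q (UMul t u) = Q t * Q u.
Proof. by rewrite -env_mulE. Qed.

Fact env_scalA c d x : env_scal c (env_scal d x) = env_scal (c * d) x.
Proof.
rewrite (reprE x) !env_scalE !pi_envelM mulrA -pi_envelM; congr (_ * _).
by symmetry; apply/envelP; apply: ueq_constM.
Qed.

Fact env_scal1 : left_id 1 env_scal.
Proof. by move=> x; rewrite (reprE x) env_scalE pi_envelM mul1r. Qed.

Fact env_scalDr : right_distributive env_scal +%R.
Proof.
move=> c x y; rewrite (reprE x) (reprE y) -pi_envelD !env_scalE !pi_envelM.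
by rewrite pi_envelD mulrDr.
Qed.

Fact env_scalDl x : {morph env_scal^~ x : c d / c + d}.
Proof.
move=> c d; rewrite (reprE x) !env_scalE !pi_envelM -mulrDl; congr (_ * _).
by rewrite -pi_envelD; apply/envelP; apply: ueq_constD.
Qed.

HB.instance Definition _ := GRing.Zmodule_isLmodule.Build k envel
  env_scalA env_scal1 env_scalDr env_scalDl.

Lemma pi_envelZ c t : c *: Q t = Q (UConst c) * Q t.
Proof. by rewrite -pi_envelM -env_scalE. Qed.

Fact env_scalAl (c : k) x y : c *: (x * y) = (c *: x) * y.
Proof.
rewrite (reprE x) (reprE y) -pi_envelM !pi_envelZ.
by rewrite pi_envelM mulrA.
Qed.

HB.instance Definition _ := GRing.Lmodule_isLalgebra.Build k envel env_scalAl.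

Fact env_scalAr (c : k) x y : c *: (x * y) = x * (c *: y).
Proof.
rewrite (reprE x) (reprE y) -pi_envelM !pi_envelZ pi_envelM !mulrA.
congr (_ * _); rewrite -!pi_envelM; apply/envelP; exact: ueq_constC.
Qed.

HB.instance Definition _ := GRing.Lalgebra_isAlgebra.Build k envel env_scalAr.

Lemma pi_envelC c : Q (UConst c) = c%:A.
Proof. by rewrite -[LHS]mulr1; symmetry; exact: (pi_envelZ c (UConst 1)). Qed.

Definition envel_in (x : g) : envel := Q (UGen x).

Lemma envel_in_hom : lie_hom envel_in.
Proof.
split=> [c a b|a b].
  rewrite /envel_in pi_envelZ -pi_envelM -pi_envelD.
  by apply/envelP; apply: ueq_genP.
rewrite -scaleN1r -!pi_envelM pi_envelZ -pi_envelM -pi_envelD.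
by apply/envelP; apply: ueq_genL.
Qed.

Lemma envel_ind (P : envel -> Prop) :
  (forall a : g, P (envel_in a)) -> (forall c : k, P c%:A) ->
  (forall x y, P x -> P y -> P (x + y)) ->
  (forall x y, P x -> P y -> P (x * y)) -> forall x, P x.
Proof.
move=> Pin Pc PD PM x; rewrite (reprE x).
elim: (repr x) => [a|c|t IHt u IHu|t IHt u IHu].
- exact: Pin.
- by rewrite pi_envelC; apply: Pc.
- by rewrite pi_envelD; apply: PD.
- by rewrite pi_envelM; apply: PM.
Qed.

Definition envel_lift (A : algType k) (f : g -> A) (x : envel) : A :=
  ueval f (repr x).

Section Lift.
Variables (A : algType k) (f : g -> A).
Hypothesis fhom : lie_hom f.

Lemma envel_liftE t : envel_lift f (Q t) = ueval f t.
Proof. exact: ueval_ueq fhom (ueq_repr t). Qed.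

Lemma envel_lift_in (a : g) : envel_lift f (envel_in a) = f a.
Proof. by rewrite envel_liftE. Qed.

Lemma envel_liftD x y : envel_lift f (x + y) = envel_lift f x + envel_lift f y.
Proof. by rewrite (reprE x) (reprE y) -pi_envelD !envel_liftE. Qed.

Lemma envel_liftM x y : envel_lift f (x * y) = envel_lift f x * envel_lift f y.
Proof. by rewrite (reprE x) (reprE y) -pi_envelM !envel_liftE. Qed.

Lemma envel_liftC c : envel_lift f c%:A = c%:A.
Proof. by rewrite -pi_envelC envel_liftE. Qed.

Lemma envel_liftZ c x : envel_lift f (c *: x) = c *: envel_lift f x.
Proof.
rewrite -[x]mul1r scalerAl !envel_liftM envel_liftC -scalerAl mul1r.
by rewrite -[1]scale1r envel_liftC scale1r mul1r.
Qed.

Lemma envel_lift_unique (h : {lrmorphism envel -> A}) :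
  (forall a : g, h (envel_in a) = f a) -> h =1 envel_lift f.
Proof.
move=> hin; elim/envel_ind=> [x|c|x y IHx IHy|x y IHx IHy].
- by rewrite hin envel_lift_in.
- by rewrite linearZ rmorph1 envel_liftC.
- by rewrite envel_liftD -IHx -IHy; exact: raddfD.
- by rewrite envel_liftM -IHx -IHy; exact: rmorphM.
Qed.

End Lift.

Definition envel_act (V : lieModType g) (x : envel) (v : V) : V :=
  uteract (repr x) v.

Lemma envel_actE (V : lieModType g) t (v : V) :
  envel_act (Q t) v = uteract t v.
Proof. exact: uteract_ueq (ueq_repr t) v. Qed.

End Enveloping.

(* A Lie module of g, seen as a left module over the enveloping algebra. *)
Definition envmod (k : comNzRingType) (g : lieAlgType k) (V : lieModType g)
  : Type := V.

Section EnvModule.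
Variables (k : comNzRingType) (g : lieAlgType k) (V : lieModType g).
Local Notation W := (envmod V).

HB.instance Definition _ := GRing.Zmodule.on W.

Let act (x : envel g) (v : W) : W := @envel_act k g V x v.
Let reprE (x : envel g) : x = \pi_(envel g) (repr x).
Proof. by rewrite reprK. Qed.

Fact envmod_scaleA x y v : act x (act y v) = act (x * y) v.
Proof. by rewrite (reprE x) (reprE y) -pi_envelM /act !envel_actE. Qed.

Fact envmod_scale1 : left_id 1 act.
Proof. by move=> v; rewrite /act envel_actE /= scale1r. Qed.

Fact envmod_scaleDr : right_distributive act +%R.
Proof.
move=> x v w; rewrite /act /envel_act -{1}[v]scale1r.
by have := uteractP (repr x) 1 v w; rewrite !scale1r.
Qed.

Fact envmod_scaleDl v : {morph act^~ v : x y / x + y}.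
Proof.
by move=> x y; rewrite (reprE x) (reprE y) -pi_envelD /act !envel_actE.
Qed.

HB.instance Definition _ := GRing.Zmodule_isLmodule.Build (envel g) W
  envmod_scaleA envmod_scale1 envmod_scaleDr envmod_scaleDl.

Lemma envmod_in (x : g) (v : W) : envel_in x *: v = lact x (v : V).
Proof. exact: envel_actE. Qed.

End EnvModule.

(* The opposite algebra: anti-homomorphisms into A are homomorphisms into A^c. *)
Section Opposite.
Variables (k : comNzRingType) (A : algType k).

Let scal (c : k) (x : A^c) : A^c := c *: (x : A).

Fact conv_scaleA c d x : scal c (scal d x) = scal (c * d) x.
Proof. exact: scalerA. Qed.

Fact conv_scale1 : left_id 1 scal.
Proof. exact: (@scale1r k A). Qed.

Fact conv_scaleDr : right_distributive scal +%R.
Proof. exact: (@scalerDr k A). Qed.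

Fact conv_scaleDl x : {morph scal^~ x : c d / c + d}.
Proof. exact: (@scalerDl k A). Qed.

HB.instance Definition _ := GRing.Zmodule_isLmodule.Build k (A^c)
  conv_scaleA conv_scale1 conv_scaleDr conv_scaleDl.

Fact conv_scaleAl (c : k) (x y : A^c) : c *: (x * y) = (c *: x) * y.
Proof. exact: (@scalerAr k A c y x). Qed.

HB.instance Definition _ := GRing.Lmodule_isLalgebra.Build k (A^c) conv_scaleAl.

Fact conv_scaleAr (c : k) (x y : A^c) : c *: (x * y) = x * (c *: y).
Proof. exact: (@scalerAl k A c y x). Qed.

HB.instance Definition _ := GRing.Lalgebra_isAlgebra.Build k (A^c) conv_scaleAr.

End Opposite.

Record gam (k : fieldType) (G : zmodClosed k) := Gam {
  gamval :> k;
  gamvalP : gamval \in G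
}.

HB.instance Definition _ (k : fieldType) (G : zmodClosed k) :=
  [isSub for @gamval k G].
HB.instance Definition _ (k : fieldType) (G : zmodClosed k) :=
  [Choice of gam G by <:].
HB.instance Definition _ (k : fieldType) (G : zmodClosed k) :=
  [SubChoice_isSubZmodule of gam G by <:].

Section GammaTheory.
Variables (k : fieldType) (G : zmodClosed k).
Implicit Types (m n l : gam G).

Lemma gamval0 : gamval (0 : gam G) = 0.
Proof. exact: (raddf0 (val : gam G -> k)). Qed.

Lemma gamvalD m n : gamval (m + n) = gamval m + gamval n.
Proof. exact: (raddfD (val : gam G -> k)). Qed.

Lemma gamval_eq0 m : (gamval m == 0) = (m == 0).
Proof. by rewrite -gamval0; apply/eqP/eqP => [/val_inj|->]. Qed.

End GammaTheory.

Definition witt (k : fieldType) (G : zmodClosed k) : Type := dsum (gam G) k.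

Section Witt.
Variables (k : fieldType) (G : zmodClosed k).
Local Notation W := (witt G).

HB.instance Definition _ := GRing.Lmodule.copy W (dsum (gam G) k).

Definition witt_e (m : gam G) : W := dmono m 1.

Definition witt_lieB (m : gam G) (a : k) (n : gam G) (b : k) : W :=
  dmono (m + n) (a * b * (gamval n - gamval m)).

(* [e_m, e_n] = (n - m) e_(n+m), extended bilinearly *)
Definition witt_lie (x y : W) : W := dext2 witt_lieB x y.

Fact witt_lieB_add : biadd witt_lieB.
Proof.
split=> [m n b a a'|m a n b b'] /=; rewrite /witt_lieB.
  by rewrite !mulrDl dmonoD.
by rewrite (mulrDr a) mulrDl dmonoD.
Qed.

Let wlU m a n b : witt_lie (dmono m a) (dmono n b) = witt_lieB m a n b.
Proof. exact: (dext2U witt_lieB_add). Qed.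
Let wlDl x y z : witt_lie (x + y) z = witt_lie x z + witt_lie y z.
Proof. exact: (dext2Dl witt_lieB_add). Qed.
Let wlDr x y z : witt_lie z (x + y) = witt_lie z x + witt_lie z y.
Proof. exact: (dext2Dr witt_lieB_add). Qed.
Let wl0l x : witt_lie 0 x = 0. Proof. exact: dext20l. Qed.
Let wl0r x : witt_lie x 0 = 0. Proof. exact: dext20r. Qed.

#[local] Opaque witt_lie.

Let wlZl c x y : witt_lie (c *: x) y = c *: witt_lie x y.
Proof.
elim/dsum_ind: x => [|m a|x x' IH IH']; last first.
- by rewrite scalerDr !wlDl scalerDr IH IH'.
- elim/dsum_ind: y => [|n b|y y' IH IH']; last first.
  + by rewrite !wlDr scalerDr IH IH'.
  + by rewrite dmonoZ !wlU /witt_lieB dmonoZ !mulrA.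
  + by rewrite !wl0r scaler0.
- by rewrite scaler0 wl0l scaler0.
Qed.

Let wlZr c x y : witt_lie x (c *: y) = c *: witt_lie x y.
Proof.
elim/dsum_ind: x => [|m a|x x' IH IH']; last first.
- by rewrite !wlDl scalerDr IH IH'.
- elim/dsum_ind: y => [|n b|y y' IH IH']; last first.
  + by rewrite scalerDr !wlDr scalerDr IH IH'.
  + by rewrite dmonoZ !wlU /witt_lieB dmonoZ; congr dmono; ring.
  + by rewrite scaler0 !wl0r scaler0.
- by rewrite !wl0l scaler0.
Qed.

Fact witt_lie_linl c x y z :
  witt_lie (c *: x + y) z = c *: witt_lie x z + witt_lie y z.
Proof. by rewrite wlDl wlZl. Qed.

Fact witt_lie_linr c x y z :
  witt_lie z (c *: x + y) = c *: witt_lie z x + witt_lie z y.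
Proof. by rewrite wlDr wlZr. Qed.

Let S (a b c d : W) : a + c = 0 -> b + d = 0 -> a + b + (c + d) = 0.
Proof. by move=> h h'; rewrite addrACA h h' addr0. Qed.

Let wl_anti x y : witt_lie x y + witt_lie y x = 0.
Proof.
elim/dsum_ind: x => [|m a|x x' IH IH']; last first.
- by rewrite wlDl wlDr; apply: S.
- elim/dsum_ind: y => [|n b|y y' IH IH']; last first.
  + by rewrite wlDl wlDr; apply: S.
  + rewrite !wlU /witt_lieB (addrC n m) -dmonoD.
    by rewrite [X in dmono _ X](_ : _ = 0) ?dmono0 //; ring.
  + by rewrite wl0l wl0r addr0.
- by rewrite wl0l wl0r addr0.
Qed.

Fact witt_liexx x : witt_lie x x = 0.
Proof.
elim/dsum_ind: x => [|m a|x y IH IH'].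
- exact: wl0l.
- by rewrite wlU /witt_lieB subrr mulr0 dmono0.
- by rewrite wlDl !wlDr IH IH' addr0 add0r wl_anti.
Qed.

Fact witt_jacobi x y z : witt_lie x (witt_lie y z) + witt_lie y (witt_lie z x)
  + witt_lie z (witt_lie x y) = 0.
Proof.
have D (a b c d e f : W) :
    a + b + c = 0 -> d + e + f = 0 -> (a + d) + (b + e) + (c + f) = 0.
  by move=> h h'; rewrite (addrACA a d b e) (addrACA (a + b)) h h' addr0.
elim/dsum_ind: x => [|m a|x x' IH IH']; last first.
- by rewrite !(wlDl, wlDr); apply: D.
- elim/dsum_ind: y => [|n b|y y' IH IH']; last first.
  + by rewrite !(wlDl, wlDr); apply: D.
  + elim/dsum_ind: z => [|l c|z z' IH IH']; last first.
    * by rewrite !(wlDl, wlDr); apply: D.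
    * rewrite !wlU /witt_lieB.
      have -> : n + (l + m) = m + (n + l) by rewrite addrA addrC.
      have -> : l + (m + n) = m + (n + l) by rewrite addrCA (addrC l).
      rewrite -!dmonoD !gamvalD.
      by rewrite [X in dmono _ X](_ : _ = 0) ?dmono0 //; ring.
    * by rewrite !(wl0l, wl0r) !addr0.
  + by rewrite !(wl0l, wl0r) !addr0.
- by rewrite !(wl0l, wl0r) !addr0.
Qed.

HB.instance Definition _ := Lmodule_isLie.Build k W
  witt_lie_linl witt_lie_linr witt_liexx witt_jacobi.

Lemma witt_lieE (m n : gam G) :
  lie (witt_e m) (witt_e n) = (gamval n - gamval m) *: witt_e (n + m).
Proof. by rewrite [LHS]wlU /witt_lieB dmonoZ mulr1 mul1r mulr1 addrC. Qed.

End Witt.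

Section AModule.
Variables (k : fieldType) (G : zmodClosed k).

Definition amod_lie (al be : k) : Type := dsum (gam G) k.
HB.instance Definition _ al be :=
  GRing.Lmodule.copy (amod_lie al be) (dsum (gam G) k).

Variables (al be : k).
Local Notation A := (amod_lie al be).

Definition amod_v (n : gam G) : A := dmono n 1.

(* e_m v_n *)
Definition amod_ev (m n : gam G) : A :=
  if m + n == 0 then 0
  else if n == 0 then (al + be * gamval m) *: amod_v m
  else gamval n *: amod_v (m + n).

Definition amod_actB (m : gam G) (c : k) (n : gam G) (d : k) : A :=
  (c * d) *: amod_ev m n.

Definition amod_act (w : witt G) (v : A) : A := dext2 amod_actB w v.

Let cf (m n : gam G) : k :=
  if m + n == 0 then 0 else if n == 0 then al + be * gamval m else gamval n.

Let evE (m n : gam G) : amod_ev m n = dmono (m + n) (cf m n).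
Proof.
rewrite /amod_ev /cf /amod_v; case: (m + n == 0); first by rewrite dmono0.
by case: (n =P 0) => [->|_]; rewrite dmonoZ mulr1 ?addr0.
Qed.

Let cf_lie (m n l : gam G) : (gamval n - gamval m) * cf (m + n) l =
  cf n l * cf m (n + l) - cf m l * cf n (m + l).
Proof.
rewrite /cf (addrA m n l) (addrA n m l) (addrC n m).
case: (m + n + l =P 0) => [_|/eqP s0]; first by rewrite !mulr0 subrr.
have [l0|l0] := eqVneq l 0.
  rewrite l0 !addr0 !gamvalD.
  have [->|m0] := eqVneq m 0; have [->|n0] := eqVneq n 0; rewrite ?gamval0; ring.
have [nl|nl] := eqVneq (n + l) 0; have [ml|ml] := eqVneq (m + l) 0.
- have -> : n = m by apply: (addIr l); rewrite nl ml.
  by ring.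
- have -> : gamval n = - gamval l.
    by apply/eqP; rewrite -addr_eq0 -gamvalD nl gamval0.
  by rewrite gamvalD; ring.
- have -> : gamval m = - gamval l.
    by apply/eqP; rewrite -addr_eq0 -gamvalD ml gamval0.
  by rewrite gamvalD; ring.
- by rewrite !gamvalD; ring.
Qed.

Fact amod_actB_add : biadd amod_actB.
Proof.
split=> [m n d c c'|m c n d d'] /=; rewrite /amod_actB.
  by rewrite mulrDl scalerDl.
by rewrite mulrDr scalerDl.
Qed.

Let aU m c n d :
  amod_act (dmono m c) (dmono n d) = dmono (m + n) (c * d * cf m n).
Proof.
by rewrite [LHS](dext2U amod_actB_add) /amod_actB evE dmonoZ.
Qed.
Let aDl x y v : amod_act (x + y) v = amod_act x v + amod_act y v.
Proof. exact: (dext2Dl amod_actB_add). Qed.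
Let aDr x v w : amod_act x (v + w) = amod_act x v + amod_act x w.
Proof. exact: (dext2Dr amod_actB_add). Qed.
Let a0l v : amod_act 0 v = 0. Proof. exact: dext20l. Qed.
Let a0r x : amod_act x 0 = 0. Proof. exact: dext20r. Qed.

#[local] Opaque amod_act.

Let aZl c x v : amod_act (c *: x) v = c *: amod_act x v.
Proof.
elim/dsum_ind: x => [|m a|x x' IH IH']; last first.
- by rewrite scalerDr !aDl scalerDr IH IH'.
- elim/dsum_ind: v => [|n b|v v' IH IH']; last first.
  + by rewrite !aDr scalerDr IH IH'.
  + by rewrite dmonoZ !aU dmonoZ !mulrA.
  + by rewrite !a0r scaler0.
- by rewrite scaler0 a0l scaler0.
Qed.

Let aZr c x v : amod_act x (c *: v) = c *: amod_act x v.
Proof.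
elim/dsum_ind: x => [|m a|x x' IH IH']; last first.
- by rewrite !aDl scalerDr IH IH'.
- elim/dsum_ind: v => [|n b|v v' IH IH']; last first.
  + by rewrite scalerDr !aDr scalerDr IH IH'.
  + by rewrite dmonoZ !aU dmonoZ; congr dmono; ring.
  + by rewrite scaler0 !a0r scaler0.
- by rewrite !a0l scaler0.
Qed.

Fact amod_act_linl c x y v :
  amod_act (c *: x + y) v = c *: amod_act x v + amod_act y v.
Proof. by rewrite aDl aZl. Qed.

Fact amod_act_linr c x u v :
  amod_act x (c *: u + v) = c *: amod_act x u + amod_act x v.
Proof. by rewrite aDr aZr. Qed.

Let lieU m a n b :
  lie (dmono m a : witt G) (dmono n b : witt G) = witt_lieB m a n b.
Proof. exact: (dext2U (@witt_lieB_add k G)). Qed.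

Let lieD (x y z : witt G) : lie (x + y) z = lie x z + lie y z.
Proof. by have := lie_linl 1 x y z; rewrite !scale1r. Qed.
Let lieDr (x y z : witt G) : lie z (x + y) = lie z x + lie z y.
Proof. by have := lie_linr 1 x y z; rewrite !scale1r. Qed.
Let lie0l (x : witt G) : lie 0 x = 0.
Proof. exact: dext20l. Qed.
Let lie0r (x : witt G) : lie x 0 = 0.
Proof. exact: dext20r. Qed.

Fact amod_act_lie x y v :
  amod_act (lie x y) v = amod_act x (amod_act y v) - amod_act y (amod_act x v).
Proof.
have D (a b c d e f : A) :
    a = b - c -> d = e - f -> a + d = (b + e) - (c + f).
  by move=> -> ->; rewrite opprD addrACA.
elim/dsum_ind: x => [|m a|x x' IH IH']; last first.
- by rewrite lieD !(aDl, aDr); apply: D.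
- elim/dsum_ind: y => [|n b|y y' IH IH']; last first.
  + by rewrite lieDr !(aDl, aDr); apply: D.
  + elim/dsum_ind: v => [|l d|v v' IH IH']; last first.
    * by rewrite !(aDl, aDr); apply: D.
    * rewrite lieU /witt_lieB !aU (addrCA n m l) (addrA m n l).
      rewrite -dmonoB; congr dmono.
      have := cf_lie m n l; set p := cf (m + n) l; set q := cf n l.
      set r := cf m (n + l); set s := cf m l; set t := cf n (m + l) => h.
      have -> : a * b * (gamval n - gamval m) * d * p =
        a * b * d * ((gamval n - gamval m) * p) by ring.
      by rewrite h; ring.
    * by rewrite !a0r subrr.
  + by rewrite lie0r !(a0l, a0r) subrr.
- by rewrite lie0l !(a0l, a0r) subrr.
Qed.

HB.instance Definition _ := Lmodule_isLieModule.Build k (witt G) A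
  amod_act_linl amod_act_linr amod_act_lie.

Lemma amod_actE m n : lact (witt_e m : witt G) (amod_v n) = amod_ev m n.
Proof. by rewrite [LHS]aU evE !mul1r. Qed.

End AModule.

Definition amod (k : fieldType) (G : zmodClosed k) (al be : k) : Type :=
  envmod (amod_lie G al be).

HB.instance Definition _ (k : fieldType) (G : zmodClosed k) (al be : k) :=
  GRing.Lmodule.copy (amod G al be) (envmod (amod_lie G al be)).

(* k[a,b]; not written {mpoly k[2]} because monalg overloads that notation *)
Notation kab k := (mpoly.mpoly 2 k).

Definition pa (k : fieldType) : (kab k) := 'X_ord0.
Definition pb (k : fieldType) : (kab k) := 'X_ord_max.
Arguments pa {k}.
Arguments pb {k}.

(* p(a,b) |-> p(a+c,b) *)
Definition ptrans (k : fieldType) (c : k) (p : (kab k)) : (kab k) :=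
  p \mPo [tuple pa + c%:MP; pb].

Section Ptrans.
Variable k : fieldType.
Implicit Types (c d : k) (p q : (kab k)).

Lemma ptransD c : {morph ptrans c : p q / p + q}.
Proof. exact: comp_mpolyD. Qed.
Lemma ptransM c : {morph ptrans c : p q / p * q}.
Proof. by move=> p q; rewrite /ptrans rmorphM. Qed.
Lemma ptransZ c d p : ptrans c (d *: p) = d *: ptrans c p.
Proof. exact: comp_mpolyZ. Qed.
Lemma ptransC c d : ptrans c d%:MP = d%:MP.
Proof. exact: comp_mpolyC. Qed.
Lemma ptrans1 c : ptrans c 1 = 1.
Proof. exact: comp_mpoly1. Qed.
Lemma ptrans_a c : ptrans c pa = pa + c%:MP.
Proof. by rewrite /ptrans comp_mpolyXU. Qed.
Lemma ptrans_b c : ptrans c pb = pb.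
Proof. by rewrite /ptrans comp_mpolyXU. Qed.

Lemma mpoly2_ind (P : (kab k) -> Prop) :
  (forall c, P c%:MP) -> P pa -> P pb ->
  (forall p q, P p -> P q -> P (p + q)) ->
  (forall p q, P p -> P q -> P (p * q)) -> forall p, P p.
Proof.
move=> PC Pa Pb PD PM p; rewrite [p]mpolyE.
have P0 : P 0 by rewrite -mpolyC0.
have P1 : P 1 by rewrite -mpolyC1.
have PX j q : P q -> P (q ^+ j).
  by move=> Pq; elim: j => [|j IH]; rewrite ?expr0 ?exprS //; exact: PM.
elim/big_ind: _ => // m _; rewrite -mul_mpolyC; apply: (PM) => //.
rewrite mpolyXE_id; elim/big_ind: _ => // i _; apply: PX; case: i => [[|[|//]] h].
  by rewrite (_ : Ordinal h = ord0) //; apply: val_inj.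
by rewrite (_ : Ordinal h = ord_max) //; apply: val_inj.
Qed.

Lemma ptrans0 p : ptrans 0 p = p.
Proof.
elim/mpoly2_ind: p => [c|||p q IH IH'|p q IH IH'].
- exact: ptransC.
- by rewrite ptrans_a mpolyC0 addr0.
- exact: ptrans_b.
- by rewrite ptransD IH IH'.
- by rewrite ptransM IH IH'.
Qed.

Lemma ptrans_trans c d p : ptrans c (ptrans d p) = ptrans (c + d) p.
Proof.
elim/mpoly2_ind: p => [e|||p q IH IH'|p q IH IH'].
- by rewrite !ptransC.
- by rewrite !ptrans_a ptransD ptransC ptrans_a mpolyCD addrA.
- by rewrite !ptrans_b.
- by rewrite !ptransD IH IH'.
- by rewrite !ptransM IH IH'.
Qed.

End Ptrans.

Lemma dsum_assoc (K : choiceType) (V : zmodType)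
    (mul : dsum K V -> dsum K V -> dsum K V) :
  left_distributive mul +%R -> right_distributive mul +%R ->
  (forall x, mul 0 x = 0) -> (forall x, mul x 0 = 0) ->
  (forall i a j b l c, mul (dmono i a) (mul (dmono j b) (dmono l c)) =
     mul (mul (dmono i a) (dmono j b)) (dmono l c)) ->
  associative mul.
Proof.
move=> Dl Dr m0l m0r mU x y z.
elim/dsum_ind: x => [|i a|x x' IH IH']; last by rewrite !Dl IH IH'.
  by rewrite !m0l.
elim/dsum_ind: y => [|j b|y y' IH IH']; last by rewrite !(Dl, Dr) IH IH'.
  by rewrite !(m0l, m0r).
elim/dsum_ind: z => [|l c|z z' IH IH']; last by rewrite !Dr IH IH'.
  by rewrite !m0r.
exact: mU.
Qed.

(* T = k[a,b] x| Gamma, the direct sum of the k[a,b] t^g *)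
Definition skew (k : fieldType) (G : zmodClosed k) : Type :=
  dsum (gam G) (kab k).

HB.instance Definition _ (k : fieldType) (G : zmodClosed k) :=
  GRing.Zmodule.copy (skew G) (dsum (gam G) (kab k)).

Definition skew_mulB (k : fieldType) (G : zmodClosed k)
    (g : gam G) (p : kab k) (h : gam G) (q : kab k) : skew G :=
  dmono (g + h) (p * ptrans (gamval g) q).

(* (p t^g) (q t^h) = p q(a+g,b) t^(g+h), extended bilinearly *)
HB.lock Definition skew_mul (k : fieldType) (G : zmodClosed k) (x y : skew G)
  : skew G := dext2 (@skew_mulB k G) x y.
Arguments skew_mul {k G}.
Canonical skew_mul_unlockable := Unlockable skew_mul.unlock.

Section Skew.
Variables (k : fieldType) (G : zmodClosed k).
Local Notation T := (skew G).
Local Notation mul := (@skew_mul k G).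
Implicit Types (x y z : T) (g h : gam G) (p q : (kab k)).

Definition skew_one : T := dmono 0 1.

Fact skew_mulB_add : biadd (@skew_mulB k G).
Proof.
split=> [g h q p p'|g p h q q'] /=; rewrite /skew_mulB.
  by rewrite mulrDl dmonoD.
by rewrite ptransD mulrDr dmonoD.
Qed.

Let sU g p h q : mul (dmono g p) (dmono h q) =
  dmono (g + h) (p * ptrans (gamval g) q).
Proof. by rewrite unlock (dext2U skew_mulB_add). Qed.

Fact skew_mulDl : left_distributive mul +%R.
Proof. by move=> x y z; rewrite unlock (dext2Dl skew_mulB_add). Qed.

Fact skew_mulDr : right_distributive mul +%R.
Proof. by move=> x y z; rewrite unlock (dext2Dr skew_mulB_add). Qed.

Let s0l x : mul 0 x = 0. Proof. by rewrite unlock dext20l. Qed.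
Let s0r x : mul x 0 = 0. Proof. by rewrite unlock dext20r. Qed.

Fact skew_mulA : associative mul.
Proof.
apply: dsum_assoc; [exact: skew_mulDl|exact: skew_mulDr|exact: s0l|exact: s0r|].
by move=> g p h q l r; rewrite !sU addrA ptransM ptrans_trans gamvalD mulrA.
Qed.

Fact skew_mul1l : left_id skew_one mul.
Proof.
move=> x; elim/dsum_ind: x => [|g p|x x' IH IH'].
- exact: s0r.
- by rewrite sU add0r mul1r gamval0 ptrans0.
- by rewrite skew_mulDr IH IH'.
Qed.

Fact skew_mul1r : right_id skew_one mul.
Proof.
move=> x; elim/dsum_ind: x => [|g p|x x' IH IH'].
- exact: s0l.
- by rewrite sU addr0 ptrans1 mulr1.
- by rewrite skew_mulDl IH IH'.
Qed.

Fact skew_1neq0 : skew_one != 0.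
Proof. by rewrite /skew_one dmono_eq0 oner_neq0. Qed.

HB.instance Definition _ := GRing.Zmodule_isNzRing.Build T
  skew_mulA skew_mul1l skew_mul1r skew_mulDl skew_mulDr skew_1neq0.

Definition skew_poly p : T := dmono 0 p.
Definition skew_t g : T := dmono g 1.

Lemma dmono_mul g p h q :
  (dmono g p : T) * (dmono h q : T) = dmono (g + h) (p * ptrans (gamval g) q).
Proof. exact: sU. Qed.

Lemma skew_polyD : {morph skew_poly : p q / p + q}.
Proof. by move=> p q; rewrite /skew_poly dmonoD. Qed.

Lemma skew_polyM : {morph skew_poly : p q / p * q}.
Proof. by move=> p q; rewrite /skew_poly dmono_mul gamval0 ptrans0 addr0. Qed.

Lemma skew_poly0 : skew_poly 0 = 0.
Proof. exact: dmono0. Qed.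

Lemma skew_poly1 : skew_poly 1 = 1. Proof. by []. Qed.

Lemma skew_tD g h : skew_t g * skew_t h = skew_t (g + h).
Proof. by rewrite /skew_t dmono_mul ptrans1 mulr1. Qed.

Lemma skew_tM g p : skew_t g * skew_poly p =
  skew_poly (ptrans (gamval g) p) * skew_t g.
Proof. by rewrite /skew_t !dmono_mul ptrans1 mul1r mulr1 add0r addr0. Qed.

Lemma skew_monoE g p : dmono g p = skew_poly p * skew_t g.
Proof. by rewrite dmono_mul add0r gamval0 ptrans1 mulr1. Qed.

Definition skew_scal (c : k) x : T := skew_poly c%:MP * x.

Fact skew_scalA c d x : skew_scal c (skew_scal d x) = skew_scal (c * d) x.
Proof. by rewrite /skew_scal mpolyCM skew_polyM mulrA. Qed.

Fact skew_scal1 : left_id 1 skew_scal.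
Proof. by move=> x; rewrite /skew_scal mpolyC1 skew_poly1 mul1r. Qed.

Fact skew_scalDr : right_distributive skew_scal +%R.
Proof. by move=> c x y; rewrite /skew_scal mulrDr. Qed.

Fact skew_scalDl x : {morph skew_scal^~ x : c d / c + d}.
Proof. by move=> c d; rewrite /skew_scal mpolyCD skew_polyD mulrDl. Qed.

HB.instance Definition _ := GRing.Zmodule_isLmodule.Build k T
  skew_scalA skew_scal1 skew_scalDr skew_scalDl.

Lemma skew_scaleE (c : k) x : c *: x = skew_poly c%:MP * x.
Proof. by []. Qed.

Fact skew_scaleAl (c : k) x y : c *: (x * y) = (c *: x) * y.
Proof. by rewrite !skew_scaleE mulrA. Qed.

HB.instance Definition _ := GRing.Lmodule_isLalgebra.Build k T skew_scaleAl.

Fact skew_polyC_central (c : k) x : skew_poly c%:MP * x = x * skew_poly c%:MP.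
Proof.
elim/dsum_ind: x => [|g p|x x' IH IH'].
- by rewrite mulr0 mul0r.
- by rewrite !dmono_mul gamval0 ptrans0 ptransC addr0 add0r mulrC.
- by rewrite mulrDl mulrDr IH IH'.
Qed.

Fact skew_scaleAr (c : k) x y : c *: (x * y) = x * (c *: y).
Proof. by rewrite !skew_scaleE mulrA skew_polyC_central mulrA. Qed.

HB.instance Definition _ := GRing.Lalgebra_isAlgebra.Build k T skew_scaleAr.

End Skew.

Section Phi.
Variables (k : fieldType) (G : zmodClosed k).
Local Notation T := (skew G).
Local Notation U := (envel (witt G)).

(* e_m |-> (a + b m) t^m *)
Definition Phi_e (m : gam G) : T :=
  skew_poly G (pa + gamval m *: pb) * skew_t m.

Definition Phi_lie (w : witt G) : T^c := dext (fun m (c : k) => c *: Phi_e m) w.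

Let pU m c : Phi_lie (dmono m c) = dmono m (c *: (pa + gamval m *: pb)).
Proof.
rewrite [LHS]dextU => [|i]; last by rewrite scale0r.
by rewrite /Phi_e -skew_monoE skew_scaleE dmono_mul gamval0 ptrans0 add0r mul_mpolyC.
Qed.

Let pD x y : Phi_lie (x + y) = Phi_lie x + Phi_lie y.
Proof. by apply: dextD => i c d; exact: scalerDl. Qed.

Let p0 : Phi_lie 0 = 0. Proof. exact: dext0. Qed.

#[local] Opaque Phi_lie.

Let lieU m a n b :
  lie (dmono m a : witt G) (dmono n b : witt G) = witt_lieB m a n b.
Proof. exact: (dext2U (@witt_lieB_add k G)). Qed.

Let lieD (x y z : witt G) : lie (x + y) z = lie x z + lie y z.
Proof. by have := lie_linl 1 x y z; rewrite !scale1r. Qed.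
Let lieDr (x y z : witt G) : lie z (x + y) = lie z x + lie z y.
Proof. by have := lie_linr 1 x y z; rewrite !scale1r. Qed.
Let lie0l (x : witt G) : lie 0 x = 0.
Proof. exact: dext20l. Qed.
Let lie0r (x : witt G) : lie x 0 = 0.
Proof. exact: dext20r. Qed.

Let wind (P : witt G -> Prop) : P 0 -> (forall m c, P (dmono m c)) ->
  (forall x y, P x -> P y -> P (x + y)) -> forall x, P x.
Proof. exact: dsum_ind. Qed.

Lemma Phi_lie_hom : lie_hom Phi_lie.
Proof.
split=> [c x y|x y].
  rewrite pD; congr (_ + _).
  elim/wind: x => [|m a|x x' IH IH'].
  - by rewrite scaler0 p0 scaler0.
  - rewrite dmonoZ !pU -scalerA [RHS]skew_scaleE.
    by rewrite dmono_mul gamval0 ptrans0 add0r mul_mpolyC.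
  - by rewrite scalerDr !pD scalerDr IH IH'.
have Dl (a a' c u v : T^c) : u = a * c - c * a -> v = a' * c - c * a' ->
    u + v = (a + a') * c - c * (a + a').
  by move=> -> ->; rewrite mulrDl mulrDr opprD addrACA.
have Dr (a a' c u v : T^c) : u = c * a - a * c -> v = c * a' - a' * c ->
    u + v = c * (a + a') - (a + a') * c.
  by move=> -> ->; rewrite mulrDl mulrDr opprD addrACA.
have D0 (a : T^c) : 0 = 0 * a - a * 0 by rewrite mulr0 mul0r subrr.
have D0' (a : T^c) : 0 = a * 0 - 0 * a by rewrite mulr0 mul0r subrr.
elim/wind: x => [|m a|x x' IH IH']; last first.
- rewrite lieD (pD (lie x y)) (pD x x'); exact: Dl IH IH'.
- elim/wind: y => [|n b|y y' IH IH']; last first.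
  + rewrite lieDr (pD (lie _ y) (lie _ y')) (pD y y'); exact: Dr IH IH'.
  + rewrite lieU /witt_lieB !pU.
    pose P := pa + gamval m *: pb; pose Q := pa + gamval n *: pb.
    transitivity ((dmono n (b *: Q) : T) * (dmono m (a *: P) : T) -
      (dmono m (a *: P) : T) * (dmono n (b *: Q) : T)); last by [].
    rewrite !dmono_mul (addrC n m) -dmonoB; congr dmono.
    rewrite /P /Q !ptransZ !ptransD !ptransZ !ptrans_a !ptrans_b.
    rewrite gamvalD -!mul_mpolyC !(mpolyCM, mpolyCD, mpolyCN); ring.
  + by rewrite lie0r p0; apply: D0'.
- by rewrite lie0l p0; apply: D0.
Qed.

(* The lift lands in T^c, so Phi reverses products: see PhiM. *)
Definition Phi (u : U) : T := envel_lift Phi_lie u.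

Lemma Phi_eE m : Phi (envel_in (witt_e m)) = Phi_e m.
Proof.
rewrite /Phi (envel_lift_in Phi_lie_hom) pU scale1r.
exact: skew_monoE.
Qed.

Lemma PhiD u v : Phi (u + v) = Phi u + Phi v.
Proof. exact: (envel_liftD Phi_lie_hom). Qed.

Lemma PhiM u v : Phi (u * v) = Phi v * Phi u.
Proof. exact: (envel_liftM Phi_lie_hom). Qed.

Lemma PhiZ c u : Phi (c *: u) = c *: Phi u.
Proof. exact: (envel_liftZ Phi_lie_hom). Qed.

Lemma Phi1 : Phi 1 = 1.
Proof.
by have := envel_liftC Phi_lie_hom 1; rewrite !scale1r.
Qed.

End Phi.

Definition ideal_gen (R : comNzRingType) (s : seq R) (p : R) : Prop :=
  exists c : 'I_(size s) -> R, p = \sum_(i < size s) c i * s`_i.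

Section IdealGen.
Variables (R : comNzRingType) (s : seq R).

Lemma ideal_gen0 : ideal_gen s 0.
Proof. by exists (fun _ => 0); rewrite big1 // => i _; rewrite mul0r. Qed.

Lemma ideal_genD p q : ideal_gen s p -> ideal_gen s q -> ideal_gen s (p + q).
Proof.
case=> c -> [d ->]; exists (fun i => c i + d i).
by rewrite -big_split; apply: eq_bigr => i _; rewrite mulrDl.
Qed.

Lemma ideal_genM p q : ideal_gen s q -> ideal_gen s (p * q).
Proof.
case=> c ->; exists (fun i => p * c i).
by rewrite mulr_sumr; apply: eq_bigr => i _; rewrite mulrA.
Qed.

Lemma ideal_gen_mem p : p \in s -> ideal_gen s p.
Proof.
move=> ps; have lt : (index p s < size s)%N by rewrite index_mem.
exists (fun i => (i == Ordinal lt)%:R).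
rewrite (bigD1 (Ordinal lt)) //= eqxx mul1r nth_index // big1 ?addr0 //.
by move=> i /negPf ->; rewrite mul0r.
Qed.

End IdealGen.

Definition I00 (k : fieldType) : kab k -> Prop := ideal_gen [:: pa; pb].

Definition Iq (k : fieldType) (x y : k) : kab k -> Prop :=
  ideal_gen [:: y *: pa - x *: pb; pa ^+ 2; pa * pb; pb ^+ 2].

(* I T: finite sums of products p w with p in I, w in T *)
Definition rideal (k : fieldType) (G : zmodClosed k) (I : kab k -> Prop)
    (z : skew G) : Prop :=
  exists2 s : seq (kab k * skew G), (forall u, u \in s -> I u.1) &
    z = \sum_(u <- s) skew_poly G u.1 * u.2.

Section RIdeal.
Variables (k : fieldType) (G : zmodClosed k) (I : kab k -> Prop).
Implicit Types (z w : skew G).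

Lemma rideal0 : rideal I (0 : skew G).
Proof. by exists [::]; rewrite ?big_nil. Qed.

Lemma ridealD z w : rideal I z -> rideal I w -> rideal I (z + w).
Proof.
case=> s sI -> [t tI ->]; exists (s ++ t); last by rewrite big_cat.
by move=> u; rewrite mem_cat => /orP[/sI|/tI].
Qed.

Lemma ridealM z w : rideal I z -> rideal I (z * w).
Proof.
case=> s sI ->; exists [seq (u.1, u.2 * w) | u <- s].
  by move=> u /mapP[v /sI vI ->].
by rewrite big_map mulr_suml; apply: eq_bigr => u _ /=; rewrite mulrA.
Qed.

Lemma ridealZ c z : rideal I z -> rideal I (skew_poly G c%:MP * z).
Proof.
case=> s sI ->; exists [seq (u.1, skew_poly G c%:MP * u.2) | u <- s].
  by move=> u /mapP[v /sI vI ->].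
rewrite big_map mulr_sumr; apply: eq_bigr => u _.
have h q w : skew_poly G c%:MP * (skew_poly G q * w) =
    skew_poly G q * (skew_poly G c%:MP * w).
  by rewrite mulrA (skew_polyC_central c (skew_poly G q)) -mulrA.
exact: h.
Qed.

Lemma ridealN z : rideal I z -> rideal I (- z).
Proof. by move=> Iz; rewrite -[z]mulr1 -mulrN; apply: ridealM. Qed.

Lemma rideal_mem p z : I p -> rideal I (skew_poly G p * z).
Proof.
move=> Ip; exists [:: (p, z)]; last by rewrite big_seq1.
by move=> u; rewrite inE => /eqP ->.
Qed.

End RIdeal.

(* The numerator k[a,b] + I(0,0) T of P(q). *)
Definition pnum (k : fieldType) (G : zmodClosed k) (z : skew G) : Prop :=
  exists p w, rideal (@I00 k) w /\ z = skew_poly G p + w.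

(* The denominator I(0,0) + I(q) T of P(q). *)
Definition pden (k : fieldType) (G : zmodClosed k) (x y : k) (z : skew G)
  : Prop :=
  exists p w, [/\ I00 p, rideal (Iq x y) w & z = skew_poly G p + w].

(* The subalgebra B = Phi(U(W)) of T. *)
Definition inB (k : fieldType) (G : zmodClosed k) (z : skew G) : Prop :=
  exists u, z = Phi u.

Section Pmodule.
Variables (k : fieldType) (G : zmodClosed k) (x y : k).
Local Notation T := (skew G).
Local Notation U := (envel (witt G)).
Implicit Types (z w : T).

Lemma pnum0 : pnum (0 : T).
Proof.
exists 0, 0; split; first exact: rideal0.
by rewrite skew_poly0 addr0.
Qed.

Lemma pnumD z w : pnum z -> pnum w -> pnum (z + w).
Proof.
case=> p [z' [hz ->]] [q [w' [hw ->]]]; exists (p + q), (z' + w').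
split; first exact: ridealD.
by rewrite skew_polyD addrACA.
Qed.

Lemma skew_polyN p : skew_poly G (- p) = - skew_poly G p.
Proof. exact: dmonoN. Qed.

Lemma pnumN z : pnum z -> pnum (- z).
Proof.
case=> p [z' [hz ->]]; exists (- p), (- z'); split; first exact: ridealN.
by rewrite skew_polyN opprD.
Qed.

Lemma pden0 : pden x y (0 : T).
Proof.
exists 0, 0; split; [exact: ideal_gen0 | exact: rideal0 |].
by rewrite skew_poly0 addr0.
Qed.

Lemma pdenD z w : pden x y z -> pden x y w -> pden x y (z + w).
Proof.
case=> p [z' [hp hz ->]] [q [w' [hq hw ->]]]; exists (p + q), (z' + w').
split; [exact: ideal_genD | exact: ridealD |].
by rewrite skew_polyD addrACA.
Qed.

Lemma pdenN z : pden x y z -> pden x y (- z).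
Proof.
case=> p [z' [hp hz ->]]; exists (- p), (- z'); split.
- by rewrite -mulN1r; apply: ideal_genM.
- exact: ridealN.
- by rewrite skew_polyN opprD.
Qed.

Lemma Iq_sub p : Iq x y p -> I00 p.
Proof.
have Ia : I00 (pa : kab k) by apply: ideal_gen_mem; rewrite inE eqxx.
have Ib : I00 (pb : kab k) by apply: ideal_gen_mem; rewrite !inE eqxx orbT.
case=> c ->; rewrite !big_ord_recl big_ord0 /=.
do 4?[apply: ideal_genD; first apply: ideal_genM]; last exact: ideal_gen0.
- rewrite -!mul_mpolyC; apply: ideal_genD; first exact: ideal_genM.
  by rewrite -mulNr; apply: ideal_genM.
- exact: ideal_genM.
- exact: ideal_genM.
- exact: ideal_genM.
Qed.

Lemma pden_sub z : pden x y z -> pnum z.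
Proof.
case=> p [w [_ [s sI ->] ->]]; exists p, (\sum_(u <- s) skew_poly G u.1 * u.2).
by split=> //; exists s => // u /sI; apply: Iq_sub.
Qed.

Let I00_e (m : gam G) : I00 (pa + gamval m *: pb).
Proof.
apply: ideal_genD; first by apply: ideal_gen_mem; rewrite inE eqxx.
rewrite -mul_mpolyC; apply: ideal_genM.
by apply: ideal_gen_mem; rewrite !inE eqxx orbT.
Qed.

Let Iq_sqr p q : I00 p -> I00 q -> Iq x y (p * q).
Proof.
have in2 : Iq x y (pa ^+ 2) by apply: ideal_gen_mem; rewrite !inE eqxx ?orbT.
have in3 : Iq x y (pa * pb) by apply: ideal_gen_mem; rewrite !inE eqxx ?orbT.
have in4 : Iq x y (pb ^+ 2) by apply: ideal_gen_mem; rewrite !inE eqxx ?orbT.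
case=> c -> [d ->]; rewrite !big_ord_recl !big_ord0 /= !addr0.
set c0 := c _; set c1 := c _; set d0 := d _; set d1 := d _.
have -> : (c0 * pa + c1 * pb) * (d0 * pa + d1 * pb) =
  c0 * d0 * pa ^+ 2 + (c0 * d1 + c1 * d0) * (pa * pb) + c1 * d1 * pb ^+ 2.
  ring.
by apply: ideal_genD; [apply: ideal_genD|]; apply: ideal_genM.
Qed.

Let poly_Phi_e p m : skew_poly G p * Phi_e m =
  skew_poly G (p * (pa + gamval m *: pb)) * skew_t m.
Proof. by rewrite /Phi_e (mulrA _ (skew_poly G _) (skew_t m)) -(skew_polyM G p (pa + gamval m *: pb)). Qed.

(* Induction on u: the predicates below are stable under generators, scalars,
   sums and products. *)
Let stable_ind (P : T -> Prop) :
  (forall z w, P z -> P w -> P (z + w)) ->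
  (forall c z, P z -> P (skew_poly G c%:MP * z)) ->
  (forall m z, P z -> P (z * Phi_e m)) ->
  P 0 -> forall u z, P z -> P (z * Phi u).
Proof.
move=> PD PC Pe P0; elim/envel_ind=> [a|c|u v IHu IHv|u v IHu IHv] z Pz.
- have wind (Q : witt G -> Prop) : Q 0 -> (forall m c, Q (dmono m c)) ->
    (forall a b, Q a -> Q b -> Q (a + b)) -> forall a, Q a := @dsum_ind _ _ Q.
  have [inZ _] := @envel_in_hom k (witt G).
  have inD (b d : witt G) : envel_in (b + d) = envel_in b + envel_in d.
    by have := inZ 1 b d; rewrite !scale1r.
  have Phi0 : Phi (0 : U) = 0.
    by apply: (addrI (Phi (0 : U))); rewrite -PhiD !addr0.
  have in0 : envel_in (0 : witt G) = 0.
    by apply: (addrI (envel_in (0 : witt G))); rewrite -inD !addr0.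
  elim/wind: a => [|m c|b d IHb IHd].
  + by rewrite in0 Phi0 mulr0.
  + have -> : dmono m c = c *: witt_e m + 0 :> witt G.
      by rewrite addr0 [RHS]dmonoZ mulr1.
    rewrite inZ in0 addr0 PhiZ Phi_eE skew_scaleE skew_polyC_central.
    by rewrite mulrA -skew_polyC_central; apply/PC/Pe.
  + rewrite inD PhiD (mulrDr z); exact: PD IHb IHd.
- by rewrite PhiZ Phi1 skew_scaleE mulr1 -skew_polyC_central; apply: PC.
- by rewrite PhiD mulrDr; apply: PD; [exact: IHu | exact: IHv].
- by rewrite PhiM mulrA; apply/IHu/IHv.
Qed.

Lemma pnum_stable z b : pnum z -> inB b -> pnum (z * b).
Proof.
move=> + [u ->]; move: u z; apply: stable_ind; last exact: pnum0.
- exact: pnumD.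
- move=> c z [p [w [hw ->]]]; exists (c%:MP * p), (skew_poly G c%:MP * w).
  by split; [exact: ridealZ | rewrite mulrDr -skew_polyM].
- move=> m z [p [w [hw ->]]].
  exists 0, (skew_poly G (p * (pa + gamval m *: pb)) * skew_t m + w * Phi_e m).
  split; last by rewrite skew_poly0 add0r (mulrDl _ w) (poly_Phi_e p).
  apply: ridealD; [apply: rideal_mem | exact: ridealM].
  exact: ideal_genM (I00_e m).
Qed.

Lemma pden_stable z b : pden x y z -> inB b -> pden x y (z * b).
Proof.
move=> + [u ->]; move: u z; apply: stable_ind; last exact: pden0.
- exact: pdenD.
- move=> c z [p [w [hp hw ->]]]; exists (c%:MP * p), (skew_poly G c%:MP * w).
  split; [exact: ideal_genM | exact: ridealZ |].
  by rewrite mulrDr -skew_polyM.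
- move=> m z [p [w [hp hw ->]]].
  exists 0, (skew_poly G (p * (pa + gamval m *: pb)) * skew_t m + w * Phi_e m).
  split; first exact: ideal_gen0.
    apply: ridealD; [apply: rideal_mem | exact: ridealM].
    exact: Iq_sqr (I00_e m).
  by rewrite skew_poly0 add0r (mulrDl _ w) (poly_Phi_e p).
Qed.

End Pmodule.

Definition pnumb (k : fieldType) (G : zmodClosed k) : {pred skew G} :=
  fun z => `[< pnum z >].

Fact pnumb_closed (k : fieldType) (G : zmodClosed k) : zmod_closed (@pnumb k G).
Proof.
split=> [|z w /asboolP hz /asboolP hw]; apply/asboolP; first exact: pnum0.
by apply: pnumD => //; apply: pnumN.
Qed.

HB.instance Definition _ (k : fieldType) (G : zmodClosed k) :=
  GRing.isZmodClosed.Build (skew G) (@pnumb k G) (@pnumb_closed k G).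

Record pnum_type (k : fieldType) (G : zmodClosed k) := Pnum {
  pnum_val :> skew G;
  pnum_valP : pnum_val \in @pnumb k G
}.

HB.instance Definition _ (k : fieldType) (G : zmodClosed k) :=
  [isSub for @pnum_val k G].
HB.instance Definition _ (k : fieldType) (G : zmodClosed k) :=
  [Choice of pnum_type G by <:].
HB.instance Definition _ (k : fieldType) (G : zmodClosed k) :=
  [SubChoice_isSubZmodule of pnum_type G by <:].

Definition pdenb (k : fieldType) (G : zmodClosed k) (x y : k) :
  {pred pnum_type G} := fun z => `[< pden x y (pnum_val z) >].

Section PQuotient.
Variables (k : fieldType) (G : zmodClosed k) (x y : k).
Local Notation N := (pnum_type G).
Local Notation U := (envel (witt G)).

Let valD (z w : N) : pnum_val (z + w) = pnum_val z + pnum_val w.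
Proof. exact: (raddfD (val : N -> skew G)). Qed.
Let valB (z w : N) : pnum_val (z - w) = pnum_val z - pnum_val w.
Proof. exact: (raddfB (val : N -> skew G)). Qed.
Let val0 : pnum_val (0 : N) = 0.
Proof. exact: (raddf0 (val : N -> skew G)). Qed.

Fact pdenb_closed : zmod_closed (pdenb x y : {pred N}).
Proof.
split=> [|z w /asboolP hz /asboolP hw]; apply/asboolP.
  by rewrite val0; apply: pden0.
by rewrite valB; apply: pdenD => //; apply: pdenN.
Qed.

HB.instance Definition _ :=
  GRing.isZmodClosed.Build N (pdenb x y) pdenb_closed.

Fact pnum_actP (u : U) (m : N) : pnum_val m * Phi u \in @pnumb k G.
Proof.
apply/asboolP; apply: pnum_stable; last by exists u.
by apply/asboolP; exact: (pnum_valP m).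
Qed.

Definition pnum_act (u : U) (m : N) : N := Pnum (pnum_actP u m).

(* The denominator is contained in the numerator by pden_sub, so this is the
   quotient of right B-modules (pnum_stable, pden_stable), on which u in U(W)
   acts by m |-> m Phi(u). *)
Definition pmod : Type := Quotient.quot (pdenb x y : {pred N}).

HB.instance Definition _ := GRing.Zmodule.on pmod.
HB.instance Definition _ := EqQuotient.on pmod.

Definition pmod_act (u : U) (m : pmod) : pmod := \pi_pmod (pnum_act u (repr m)).

Lemma pmod_actE u m : pmod_act u (\pi_pmod m) = \pi_pmod (pnum_act u m).
Proof.
apply/eqP; rewrite -Quotient.idealrBE; apply/asboolP.
rewrite valB /= -mulrBl -valB; apply: pden_stable; last by exists u.
have : repr (\pi_pmod m) - m \in (pdenb x y : {pred N}).
  by rewrite Quotient.idealrBE reprK.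
by move/asboolP.
Qed.

Let reprE (m : pmod) : m = \pi_pmod (repr m). Proof. by rewrite reprK. Qed.

Let vinj : injective (@pnum_val k G) := val_inj.
Let actV u (m : N) : pnum_val (pnum_act u m) = pnum_val m * Phi u := erefl.

Fact pmod_scaleA u v m : pmod_act u (pmod_act v m) = pmod_act (u * v) m.
Proof.
rewrite (reprE m) !pmod_actE; congr (\pi_pmod _).
by apply: vinj; rewrite !actV PhiM mulrA.
Qed.

Fact pmod_scale1 : left_id 1 pmod_act.
Proof.
move=> m; rewrite (reprE m) pmod_actE; congr (\pi_pmod _).
by apply: vinj; rewrite actV Phi1 mulr1.
Qed.

Fact pmod_scaleDr : right_distributive pmod_act +%R.
Proof.
have piD (a b : N) : \pi_pmod (a + b) = \pi_pmod a + \pi_pmod b.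
  exact: (raddfD (\pi_(Quotient.quot (pdenb x y : {pred N})))).
move=> u m n; rewrite (reprE m) (reprE n) -piD !pmod_actE -piD.
by congr (\pi_pmod _); apply: vinj; rewrite !(actV, valD) mulrDl.
Qed.

Fact pmod_scaleDl m : {morph pmod_act^~ m : u v / u + v}.
Proof.
have piD (a b : N) : \pi_pmod (a + b) = \pi_pmod a + \pi_pmod b.
  exact: (raddfD (\pi_(Quotient.quot (pdenb x y : {pred N})))).
move=> u v; rewrite (reprE m) !pmod_actE -piD.
by congr (\pi_pmod _); apply: vinj; rewrite !(actV, valD) PhiD mulrDr.
Qed.

HB.instance Definition _ := GRing.Zmodule_isLmodule.Build U pmod
  pmod_scaleA pmod_scale1 pmod_scaleDr pmod_scaleDl.

Lemma pmod_scaleE (u : U) (m : N) :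
  u *: (\pi_pmod m : pmod) = \pi_pmod (pnum_act u m).
Proof. exact: pmod_actE. Qed.

End PQuotient.

(* Main.v *)
Require Import Defs.
From HB Require Import structures.
From mathcomp Require Import all_boot all_order all_algebra.
From mathcomp Require Import ring boolp.
From mathcomp.multinomials Require Import monalg mpoly.

(* The numerator of P(q) consists of the z in T whose coefficients z_n, n <> 0,
   vanish at the origin; the denominator asks moreover that z_0 vanish there and
   that z_n lie in I(q), i.e. that its derivative at the origin in the direction
   (x, y) be zero.  So z |-> z_0(0,0) v_0 + sum_(n <> 0) (d_(x,y) z_n)(0,0) v_n
   identifies P(q) with A_[x:y] as a vector space.  It respects the action of
   e_m because p t^n (a + m b) t^m = p (a + n + m b) t^(n+m), whose directional
   derivative at the origin is n (d p)(0,0) if n <> 0, since then p(0,0) = 0,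
   and is (x + m y) p(0,0) if n = 0. *)

Set Implicit Arguments.
Unset Strict Implicit.
Unset Printing Implicit Defensive.

Import GRing.Theory.
Local Open Scope ring_scope.
Local Open Scope quotient_scope.

(* all_algebra also defines a notation skew, for bilinear forms *)
Local Notation skew := Defs.skew.

(** * Value and directional derivative at the origin, and the ideals they cut out *)

Section InfinitesimalIdeals.
Variables (k : fieldType) (x y : k).
Implicit Types (p q : kab k) (c : k).

Definition ev0 p : k := p.@[fun=> 0].
Definition tangent p : k := x * ev0 p^`M(ord0) + y * ev0 p^`M(ord_max).

Lemma ev0D p q : ev0 (p + q) = ev0 p + ev0 q. Proof. exact: mevalD. Qed.
Lemma ev0M p q : ev0 (p * q) = ev0 p * ev0 q. Proof. exact: mevalM. Qed.
Lemma ev0_0 : ev0 0 = 0. Proof. exact: meval0. Qed.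
Lemma ev0_1 : ev0 1 = 1. Proof. exact: meval1. Qed.
Lemma ev0C c : ev0 c%:MP = c. Proof. exact: mevalC. Qed.
Lemma ev0_a : ev0 pa = 0. Proof. exact: mevalXU. Qed.
Lemma ev0_b : ev0 pb = 0. Proof. exact: mevalXU. Qed.

Lemma tangentD p q : tangent (p + q) = tangent p + tangent q.
Proof. by rewrite /tangent !mderivD !ev0D; ring. Qed.

Lemma tangentM p q :
  tangent (p * q) = tangent p * ev0 q + ev0 p * tangent q.
Proof. by rewrite /tangent !mderivM !ev0D !ev0M; ring. Qed.

Lemma tangentC c : tangent c%:MP = 0.
Proof. by rewrite /tangent !mderivC !ev0C; ring. Qed.

Lemma tangent_a : tangent pa = x.
Proof.
rewrite /tangent !mderivX !mnm1E /= mulr0n mulr1n.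
rewrite (_ : (U_(ord0) - U_(ord0))%MM = 0%MM); last first.
  by apply/mnmP=> i; rewrite mnmBE mnm0E subnn.
by rewrite mpolyX0 scale1r scale0r ev0_0 ev0_1; ring.
Qed.

Lemma tangent_b : tangent pb = y.
Proof.
rewrite /tangent !mderivX !mnm1E /= mulr0n mulr1n.
rewrite (_ : (U_(ord_max) - U_(ord_max))%MM = 0%MM); last first.
  by apply/mnmP=> i; rewrite mnmBE mnm0E subnn.
by rewrite mpolyX0 scale1r scale0r ev0_0 ev0_1; ring.
Qed.

Definition tangentE := (tangentD, tangentM, tangentC, tangent_a, tangent_b,
  ev0D, ev0M, ev0C, ev0_a, ev0_b).

Lemma I00_a : I00 (pa : kab k).
Proof. by apply: ideal_gen_mem; rewrite inE eqxx. Qed.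

Lemma I00_b : I00 (pb : kab k).
Proof. by apply: ideal_gen_mem; rewrite !inE eqxx orbT. Qed.

Lemma I00_ev0 p : I00 p -> ev0 p = 0.
Proof.
by case=> c ->; rewrite !big_ord_recl big_ord0 /= addr0 !tangentE; ring.
Qed.

Lemma Iq_tangent p : Iq x y p -> tangent p = 0.
Proof.
case=> c ->; rewrite !big_ord_recl big_ord0 /= addr0.
by rewrite -!mul_mpolyC -mulNr -mpolyCN !expr2 !tangentE; ring.
Qed.

Lemma Iq_gens : [/\ Iq x y (y%:MP * pa - x%:MP * pb), Iq x y (pa * pa),
  Iq x y (pa * pb) & Iq x y (pb * pb)].
Proof.
by split; apply: ideal_gen_mem; rewrite ?mul_mpolyC -?expr2 !inE eqxx ?orbT.
Qed.

(** First-order Taylor expansion at the origin: I(q) contains all monomials of degree 2, so [r]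
    absorbs everything beyond the linear part. *)
Lemma linear_mod_Iq p : exists c d r,
  Iq x y r /\ p = (ev0 p)%:MP + c%:MP * pa + d%:MP * pb + r.
Proof.
have [_ Iaa Iab Ibb] := Iq_gens.
elim/mpoly2_ind: p => [c|||p q [c [d [r [Ir ->]]]] [c' [d' [r' [Ir' ->]]]]
    |p q [c [d [r [Ir ->]]]] [c' [d' [r' [Ir' ->]]]]].
- by exists 0, 0, 0; split; [exact: ideal_gen0|rewrite ev0C mpolyC0; ring].
- exists 1, 0, 0; split; first exact: ideal_gen0.
  by rewrite ev0_a mpolyC0 mpolyC1; ring.
- exists 0, 1, 0; split; first exact: ideal_gen0.
  by rewrite ev0_b mpolyC0 mpolyC1; ring.
- exists (c + c'), (d + d'), (r + r'); split; first exact: ideal_genD.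
  have e s : Iq x y s -> ev0 s = 0 by move/Iq_sub/I00_ev0.
  rewrite !tangentE (e r) // (e r') //.
  by rewrite !(mpolyCD, mpolyCM, mpolyC0); ring.
- have e s : Iq x y s -> ev0 s = 0 by move/Iq_sub/I00_ev0.
  rewrite !tangentE (e r) // (e r') //.
  move: (ev0 p) (ev0 q) => u v.
  (* The linear coefficients follow the Leibniz rule; the quadratic products and all terms with a
     factor [r] or [r'] form the remainder. *)
  exists (u * c' + v * c), (u * d' + v * d), (c%:MP * c'%:MP * (pa * pa) +
    ((c%:MP * d'%:MP + d%:MP * c'%:MP) * (pa * pb) +
     (d%:MP * d'%:MP * (pb * pb) +
      ((u%:MP + c%:MP * pa + d%:MP * pb + r) * r' +
       (v%:MP + c'%:MP * pa + d'%:MP * pb) * r)))).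
  split; first by do 4?[apply: ideal_genD]; apply: ideal_genM.
  by rewrite !(mpolyCD, mpolyCM, mpolyC0); ring.
Qed.

Lemma ev0_I00 p : ev0 p = 0 -> I00 p.
Proof.
have [c [d [r [Ir ->]]]] := linear_mod_Iq p.
rewrite !tangentE => h; apply: ideal_genD; last exact: Iq_sub Ir.
apply: ideal_genD; last by apply: ideal_genM; exact: I00_b.
apply: ideal_genD; last by apply: ideal_genM; exact: I00_a.
(* The expansion expresses [p] through [ev0 p] itself, so [h] still contains [ev0 p] and is solved
   for it. *)
have -> : ev0 p = 0.
  by rewrite -h (I00_ev0 (Iq_sub Ir)); ring.
by rewrite mpolyC0; exact: ideal_gen0.
Qed.

(** Modulo I(q), [p] is c a + d b with c x + d y = 0. As (x, y) is not zero, (c, d) is a multiple of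
    (y, -x), so c a + d b is a multiple of the generator y a - x b. *)
Lemma tangent_Iq p : (x, y) != (0, 0) -> ev0 p = 0 -> tangent p = 0 ->
  Iq x y p.
Proof.
move=> xy0 p0; have [c [d [r [Ir ->]]]] := linear_mod_Iq p; rewrite p0.
rewrite !tangentE (Iq_tangent Ir) => h.
have {}h : c * x + d * y = 0 by rewrite -[RHS]h; ring.
have [s [-> ->]] : exists s, c = s * y /\ d = - (s * x).
  have [x0|x0] := eqVneq x 0.
    have y0 : y != 0 by move: xy0; rewrite x0 xpair_eqE eqxx.
    exists (c / y); split; first by field.
    apply: (mulIf y0); rewrite -[LHS]addr0 -[d * y](addKr (c * x)) h x0; ring.
  exists (- d / x); split; last by field.
  apply: (mulIf x0); rewrite -[c * x](addrK (d * y)) h; by field.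
apply: ideal_genD => //; rewrite mpolyC0.
have -> : 0 + (s * y)%:MP * pa + (- (s * x))%:MP * pb =
    s%:MP * (y%:MP * pa - x%:MP * pb) :> kab k.
  by rewrite mpolyCN !mpolyCM; ring.
by apply: ideal_genM; have [] := Iq_gens.
Qed.

Lemma tangent_onto c : (x, y) != (0, 0) -> exists p, I00 p /\ tangent p = c.
Proof.
move=> xy0; have [x0|x0] := eqVneq x 0.
  have y0 : y != 0 by move: xy0; rewrite x0 xpair_eqE eqxx.
  exists ((c / y)%:MP * pb); split; first by apply: ideal_genM; exact: I00_b.
  by rewrite !tangentE; field.
exists ((c / x)%:MP * pa); split; first by apply: ideal_genM; exact: I00_a.
by rewrite !tangentE; field.
Qed.

End InfinitesimalIdeals.

(** * Numerator and denominator described coefficient by coefficient *)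

Section SkewCoefficients.
Variables (k : fieldType) (G : zmodClosed k).
Implicit Types (z w : skew G) (n : gam G).

Lemma skew_polyMl p n q :
  skew_poly G p * (dmono n q : skew G) = dmono n (p * q).
Proof. by rewrite dmono_mul gamval0 ptrans0 add0r. Qed.

Lemma dcoef_skew_polyM p z n : dcoef n (skew_poly G p * z) = p * dcoef n z.
Proof.
elim/dsum_ind: z => [|m q|z w IHz IHw].
- by rewrite mulr0 !monalg.mcoeff0 mulr0.
- by rewrite skew_polyMl !dcoefU mulrnAr.
- by rewrite mulrDr !monalg.mcoeffD mulrDr IHz IHw.
Qed.

(** Left multiplication by a polynomial involves no shift, so it acts on each coefficient separately
    and I T is a copy of I in every degree. *)
Lemma rideal_idealP (s : seq (kab k)) z :
  rideal (ideal_gen s) z <-> forall n, ideal_gen s (dcoef n z).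
Proof.
split=> [[t tI ->] n|zI].
  rewrite raddf_sum big_seq; elim/big_ind: _ => [||u ut].
  - exact: ideal_gen0.
  - exact: ideal_genD.
  - rewrite /= dcoef_skew_polyM mulrC; apply: ideal_genM; exact: tI.
rewrite [z]monalg.monalgE; elim/big_ind: _ => [||n _].
- exact: rideal0.
- exact: ridealD.
- have -> : monalg.mkmalgU n (dcoef n z) = skew_poly G (dcoef n z) * skew_t n.
    by rewrite -skew_monoE unlock.
  exact: rideal_mem.
Qed.

Lemma pnumP z : pnum z <-> forall n, n != 0 -> I00 (dcoef n z).
Proof.
split=> [[p [w [/rideal_idealP wI ->]]] n n0|zI].
  by rewrite monalg.mcoeffD dcoefU eq_sym (negPf n0) add0r; exact: wI.
(* All of z_0 is taken as the polynomial part, so the remainder has coefficient 0 there. *)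
exists (dcoef 0 z), (z - skew_poly G (dcoef 0 z)); split; last by rewrite addrC subrK.
apply/rideal_idealP=> n; rewrite monalg.mcoeffB dcoefU.
have [<-|n0] := eqVneq; first by rewrite subrr; exact: ideal_gen0.
by rewrite subr0; apply: zI; rewrite eq_sym.
Qed.

Lemma pdenP x y z : pden x y z <->
  I00 (dcoef 0 z) /\ forall n, n != 0 -> Iq x y (dcoef n z).
Proof.
split=> [[p [w [pI /rideal_idealP wI ->]]]|[zI zIq]].
  split=> [|n n0]; rewrite monalg.mcoeffD dcoefU.
    by rewrite eqxx mulr1n; apply: ideal_genD => //; exact: Iq_sub (wI 0).
  by rewrite eq_sym (negPf n0) add0r; exact: wI.
exists (dcoef 0 z), (z - skew_poly G (dcoef 0 z)).
split; [done| |by rewrite addrC subrK].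
apply/rideal_idealP=> n; rewrite monalg.mcoeffB dcoefU.
have [<-|n0] := eqVneq; first by rewrite subrr; exact: ideal_gen0.
by rewrite subr0; apply: zIq; rewrite eq_sym.
Qed.

End SkewCoefficients.

(** * The symbol map: kernel, image and compatibility with the action *)

Section Symbol.
Variables (k : fieldType) (G : zmodClosed k) (x y : k).
Hypothesis xy0 : (x, y) != (0, 0).
Local Notation A := (amod G x y).
Local Notation U := (envel (witt G)).
Implicit Types (z w : skew G) (n m : gam G).

Definition symbol_at n (p : kab k) : k :=
  if n == 0 then ev0 p else tangent x y p.

(** Defined on all of T so as to be additive there; it is compared with the action only on the
    numerator. *)
Definition symbol z : A := dext (fun n p => dmono n (symbol_at n p)) z.

Lemma symbol_atD n : {morph symbol_at n : p q / p + q}.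
Proof. by move=> p q; rewrite /symbol_at; case: ifP; rewrite !tangentE. Qed.

Lemma symbol_at0 n : symbol_at n 0 = 0.
Proof. by rewrite -mpolyC0 /symbol_at; case: ifP; rewrite !tangentE. Qed.

Lemma symbolD z w : symbol (z + w) = symbol z + symbol w.
Proof. by apply: dextD => n p q; rewrite symbol_atD dmonoD. Qed.

Lemma symbol0 : symbol 0 = 0. Proof. exact: dext0. Qed.

Lemma symbolN z : symbol (- z) = - symbol z.
Proof. by apply/eqP; rewrite -addr_eq0 -symbolD addNr symbol0. Qed.

Lemma symbolU n p : symbol (dmono n p) = dmono n (symbol_at n p).
Proof. by apply: dextU => m; rewrite symbol_at0 dmono0. Qed.

Lemma dcoef_symbol n z :
  dcoef n (symbol z : dsum (gam G) k) = symbol_at n (dcoef n z).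
Proof.
elim/dsum_ind: z => [|m p|z w IHz IHw].
- by rewrite symbol0 !monalg.mcoeff0 symbol_at0.
- by rewrite symbolU !dcoefU; case: eqP => [->//|_]; rewrite !mulr0n symbol_at0.
- by rewrite symbolD !monalg.mcoeffD symbol_atD IHz IHw.
Qed.

(** On the numerator the coefficients at n <> 0 already vanish at the origin, so a zero derivative
    puts them in I(q) by [tangent_Iq]. *)
Lemma symbol_eq0 z : pnum z -> (symbol z = 0 <-> pden x y z).
Proof.
move/pnumP=> zI; split=> [z0|/pdenP[zI0 zIq]].
  have h n : symbol_at n (dcoef n z) = 0 by rewrite -dcoef_symbol z0 monalg.mcoeff0.
  apply/pdenP; split=> [|n n0].
    by apply: (ev0_I00 x y); have := h 0; rewrite /symbol_at eqxx.
  apply: tangent_Iq => //; first exact/I00_ev0/zI.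
  by have := h n; rewrite /symbol_at (negPf n0).
apply/monalg.malgP=> n; rewrite dcoef_symbol monalg.mcoeff0 /symbol_at.
case: eqP => [->|/eqP n0]; first exact: I00_ev0.
exact/Iq_tangent/zIq.
Qed.

Lemma symbol_onto (v : A) : exists z : pnum_type G, symbol (pnum_val z) = v.
Proof.
suff [z zN <-] : exists2 z, pnum z & symbol z = v.
  by have zP : z \in @pnumb k G; [apply/asboolP | exists (Pnum zP)].
elim/(@dsum_ind (gam G) k): v => [|n c|v w [z zN <-] [z' zN' <-]].
- by exists 0; [exact: pnum0 | exact: symbol0].
- have [n0|n0] := eqVneq n 0.
    exists (skew_poly G c%:MP).
      apply/pnumP=> m m0; rewrite dcoefU eq_sym (negPf m0); exact: ideal_gen0.
    by rewrite symbolU /symbol_at eqxx ev0C n0.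
  have [p [pI pc]] := tangent_onto c xy0.
  exists (dmono n p); last by rewrite symbolU /symbol_at (negPf n0) pc.
  apply/pnumP=> m _; rewrite dcoefU; case: eqP => _ //; exact: ideal_gen0.
- by exists (z + z'); [exact: pnumD | exact: symbolD].
Qed.

(** The numerator is graded: [pnumP] constrains each coefficient separately, so the components of
    [z] lie in it too. *)
Lemma pnum_ind (P : skew G -> Prop) :
  P 0 -> (forall z w, P z -> P w -> P (z + w)) ->
  (forall n p, (n != 0 -> I00 p) -> P (dmono n p)) ->
  forall z, pnum z -> P z.
Proof.
move=> P0 PD PU z /pnumP zI; rewrite [z]monalg.monalgE.
elim/big_ind: _ => // n _.
by have := PU n _ (zI n); rewrite unlock.
Qed.

Lemma symbol_Phi_e m z : pnum z ->
  symbol (z * Phi_e m) = envel_in (witt_e m) *: symbol z.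
Proof.
elim/pnum_ind=> [|z' w IHz IHw|n p pI].
- by rewrite mul0r symbol0 scaler0.
- by rewrite mulrDl !symbolD scalerDr IHz IHw.
rewrite -[Phi_e m]skew_monoE dmono_mul !symbolU.
rewrite ptransD ptransZ ptrans_a ptrans_b envmod_in.
have -> : dmono n (symbol_at n p) =
    symbol_at n p *: amod_v x y n + 0 :> amod_lie G x y.
  by rewrite addr0 [RHS]dmonoZ mulr1.
rewrite lact_linr (amod_actE x y m n) /amod_ev.
have -> : lact (witt_e m) (0 : amod_lie G x y) = 0.
  exact: dext20r.
rewrite addr0 addrC /symbol_at.
rewrite -mul_mpolyC !tangentE.
(* In degree 0 the symbol is the value of p (a + n + m b) at the origin, that is n p(0,0). It
   vanishes, since n = 0 or p(0,0) = 0, in agreement with e_m v_(-m) = 0. *)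
case: (m + n =P 0) => [mn0|/eqP mn0].
  rewrite scaler0; rewrite (_ : ev0 p * _ = 0) ?dmono0 //.
  have [->|n0] := eqVneq n 0; first by rewrite gamval0; ring.
  by rewrite (I00_ev0 (pI n0)); ring.
have [n0|n0] := eqVneq n 0.
  rewrite n0 addr0 gamval0 /amod_v !dmonoZ; congr dmono; ring.
rewrite (I00_ev0 (pI n0)) /amod_v !dmonoZ; congr dmono; ring.
Qed.

(** The scalars of [amod] are those of U, so k-linearity of the symbol is expressed through the
    constants of U. *)
Lemma amod_scalarE (c : k) (v : A) :
  (c%:A : U) *: v = c *: (v : amod_lie G x y) :> amod_lie G x y.
Proof. by rewrite -pi_envelC; exact: envel_actE. Qed.

Lemma symbolZ (c : k) z : symbol (c *: z) = (c%:A : U) *: symbol z.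
Proof.
rewrite amod_scalarE.
elim/(@dsum_ind (gam G) (kab k)): z => [|n p|z w IHz IHw].
- by rewrite scaler0 symbol0 scaler0.
- rewrite skew_scaleE skew_polyMl !symbolU dmonoZ /symbol_at.
  by case: ifP; rewrite !tangentE ?mul0r ?add0r.
- by rewrite scalerDr !symbolD scalerDr IHz IHw.
Qed.

Lemma symbol_Phi u z : pnum z -> symbol (z * Phi u) = u *: symbol z.
Proof.
elim/envel_ind: u z => [a|c|u v IHu IHv|u v IHu IHv] z zN.
- have [inP _] := @envel_in_hom k (witt G).
  have in0 : envel_in (0 : witt G) = 0.
    by have := inP (-1) 0 0; rewrite scaler0 addr0 scaleN1r addNr.
  have inD (b d : witt G) : envel_in (b + d) = envel_in b + envel_in d.
    by have := inP 1 b d; rewrite !scale1r.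
  elim/(@dsum_ind (gam G) k): a => [|m c|b d IHb IHd].
  + rewrite in0 scale0r -(scale0r (0 : U)) PhiZ scale0r mulr0; exact: symbol0.
  + have -> : dmono m c = c *: witt_e m + 0 :> witt G.
      by rewrite addr0 [RHS]dmonoZ mulr1.
    rewrite inP in0 addr0 PhiZ Phi_eE -scalerAr symbolZ symbol_Phi_e //.
    by rewrite scalerA -scalerAl mul1r.
  + by rewrite inD PhiD mulrDr symbolD scalerDl IHb IHd.
- by rewrite PhiZ Phi1 -scalerAr mulr1 symbolZ.
- by rewrite PhiD mulrDr symbolD scalerDl IHu // IHv.
(* [Phi] reverses products, so the hypothesis on [u] is applied to z Phi(v), which stays in the
   numerator by [pnum_stable]. *)
- rewrite PhiM mulrA IHu ?IHv ?scalerA //.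
  by apply: pnum_stable => //; exists v.
Qed.

(** By [symbol_eq0] for z - w, the symbol is constant on classes modulo the denominator and
    separates them. *)
Lemma symbol_pi (z w : pnum_type G) :
  (symbol (pnum_val z) = symbol (pnum_val w)) <->
  (\pi_(pmod G x y) z = \pi_(pmod G x y) w).
Proof.
have eP : pnum_val (z - w) = pnum_val z - pnum_val w.
  exact: (raddfB (val : pnum_type G -> skew G)).
have zwN : pnum (pnum_val (z - w)) by apply/asboolP; exact: pnum_valP.
have := symbol_eq0 zwN; rewrite eP symbolD symbolN => e.
split=> [h|/eqP].
  apply/eqP; rewrite -Quotient.idealrBE; apply/asboolP.
  by rewrite eP; apply/e; rewrite h subrr.
rewrite -Quotient.idealrBE => /asboolP; rewrite eP => /e /eqP.
by rewrite subr_eq0 => /eqP.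
Qed.

End Symbol.

(** * Inverting the symbol map on the quotient *)

Theorem proposition3p5 (k : closedFieldType) (char0 : [pchar k] =i pred0)
    (G : zmodClosed k)
    (Gfg : exists (m : nat) (s : m.-tuple k), forall v : k, v \in G <-> inIntSpan s v)
    (x y : k) (xy_neq0 : (x, y) != (0, 0)) :
  exists f : {linear amod G x y -> pmod G x y}, bijective f.
Proof.
(* Choice of a numerator element with symbol [v]; by [fE] below, its class does not depend on the
   choice. *)
pose rep v : pnum_type G := projT1 (cid (symbol_onto xy_neq0 v)).
have repK v : symbol x y (pnum_val (rep v)) = v.
  exact: projT2 (cid (symbol_onto xy_neq0 v)).
pose f v : pmod G x y := \pi_(pmod G x y) (rep v).
have fE (z : pnum_type G) v : symbol x y (pnum_val z) = v ->
    f v = \pi_(pmod G x y) z.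
  by move=> zv; apply/symbol_pi => //; rewrite repK.
have f_linear : linear f.
  (* This element has symbol u v + w by [symbol_Phi], so its class is the value of [f] there. *)
  move=> u v w; rewrite (fE (pnum_act u (rep v) + rep w)).
    rewrite /f pmod_scaleE.
    exact: (raddfD (\pi_(Quotient.quot (pdenb x y : {pred pnum_type G})))).
  rewrite [pnum_val _](_ : _ = pnum_val (rep v) * Phi u + pnum_val (rep w)).
    rewrite symbolD symbol_Phi ?repK //; apply/asboolP; exact: pnum_valP.
  exact: (raddfD (val : pnum_type G -> skew G)).
pose F : {linear amod G x y -> pmod G x y} :=
  HB.pack f (GRing.isLinear.Build _ _ _ _ f f_linear).
exists F.
exists (fun m => symbol x y (pnum_val (repr m))) => [v|m] /=.
  by rewrite -[RHS]repK; apply/symbol_pi => //; rewrite reprK.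
by rewrite (fE (repr m)) ?reprK.
Qed.
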